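(* Let $n\in\mathbb{N}$, let $G:\mathbb{R}\to\mathbb{R}$ be an even function satisfying the regularity assumptions in the context, and for $u\in H^n(\mathbb{R})$ and $x\in\mathbb{R}$ define $$(Tu)(x)=\sum_{k=0}^n(-1)^k(G^{(k)}*u^{(k)})(x)=\langle G_{(x)}\,|\,u\rangle .$$ Then: (1) $Tu\in C_0(\mathbb{R})$ for every $u\in H^n(\mathbb{R})$, so that $T:H^n(\mathbb{R})\to C_0(\mathbb{R})$ is a well-defined linear map; (2) $T$ is bounded and $\|T\|=\|G\|$, where $\|T\|$ is the operator norm and $\|G\|$ is the $H^n(\mathbb{R})$-norm of $G$; (3) $T^*\mu=G*\mu$ for all $\mu\in\mathcal{M}(\mathbb{R})$, where $T^*:\mathcal{M}(\mathbb{R})\to H^n(\mathbb{R})^*\equiv H^n(\mathbb{R})$ is the dual map.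
   Context: Assumptions on $G$: $G:\mathbb{R}\to\mathbb{R}$ is even, the classical derivative $G^{(k)}$ of order $k$ is defined everywhere, absolutely continuous and integrable on $\mathbb{R}$ for $0\leqslant k<n$, and there exists $F\in BV(\mathbb{R})$ (an integrable function of bounded variation) that agrees with $G^{(n)}$ almost everywhere on $\mathbb{R}$. In particular $G\in H^n(\mathbb{R})$. $C_0(\mathbb{R})$ is the space of continuous real functions on $\mathbb{R}$ vanishing at infinity, with the supremum norm; its dual is identified isometrically with $\mathcal{M}(\mathbb{R})$, the finite signed Radon measures with total variation norm, via $\mu(f)=\int_{\mathbb{R}} f\,d\mu$. $H^n(\mathbb{R})$ is the real Hilbert-Sobolev space with inner product $\langle f\,|\,g\rangle=\sum_{k=0}^n\int_{\mathbb{R}}f^{(k)}(t)g^{(k)}(t)\,dt$ and associated norm $\|\cdot\|$; it is identified with its dual via this inner product. For $f:\mathbb{R}\to\mathbb{R}$ and $x\in\mathbb{R}$, $f_{(x)}(t)=f(x-t)$. Convolutions are $(f*g)(x)=\int_{\mathbb{R}} f(x-t)g(t)\,dt$ and $(f*\mu)(x)=\int_{\mathbb{R}} f(x-y)\,d\mu(y)$. *)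

(* Defs.v *)
From HB Require Import structures.
From mathcomp Require Import all_boot all_order all_algebra.
From mathcomp Require Import all_classical all_reals all_analysis.

Set Implicit Arguments.
Unset Strict Implicit.
Unset Printing Implicit Defensive.

Import Order.TTheory GRing.Theory Num.Theory.
Import numFieldNormedType.Exports.

Local Open Scope classical_set_scope.
Local Open Scope ring_scope.

Notation mu_L := lebesgue_measure.

Section function_classes.
Context {R : realType}.
Implicit Types f u v w phi G F : R -> R.

Definition even_fun f : Prop := forall x, f (- x) = f x.

(* f_(x), that is t |-> f (x - t) *)
Definition reflect_at f (x : R) : R -> R := fun t => f (x - t).

Definition abs_continuous f : Prop :=
  forall e : R, 0 < e -> exists2 d : R, 0 < d &
    forall (m : nat) (a b : 'I_m -> R),
      (forall i, a i <= b i) ->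
      trivIset setT (fun i => [set` `]a i, b i[]) ->
      \sum_(i < m) (b i - a i) < d ->
      \sum_(i < m) `|f (b i) - f (a i)| < e.

Definition BV : set (R -> R) := [set F |
  mu_L.-integrable setT (EFin \o F) /\
  exists M : R, forall a b : R, a <= b -> (total_variation a b F <= M%:E)%E].

(* [derive1n n G] is a total function, with an arbitrary value where the limit
   of the difference quotients does not exist. When 0 < n the absolute
   continuity of [derive1n n.-1 G] makes this happen only on a null set, so the
   last condition is about the genuine almost everywhere derivative. *)
Definition regular (n : nat) G : Prop :=
  [/\ forall k, (k.+1 < n)%N -> forall x, derivable (derive1n k G) x 1,
      forall k, (k < n)%N -> abs_continuous (derive1n k G),
      forall k, (k < n)%N -> mu_L.-integrable setT (EFin \o derive1n k G) &
      exists2 F, BV F & ae_eq mu_L setT (derive1n n G) F].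

(* [Lfun] asks for Borel measurability; L2 is closed under almost everywhere
   equality, hence consists of the Lebesgue measurable square integrable
   functions. *)
Definition L2 : set (R -> R) := [set u |
  exists2 v, v \in Lfun mu_L 2%:E & ae_eq mu_L setT u v].

Definition test_fun : set (R -> R) := [set phi |
  (forall k x, derivable (derive1n k phi) x 1) /\
  compact (closure [set x | phi x != 0])].

(* w is a square integrable k-th weak derivative of u *)
Definition is_weak_derive (k : nat) u w : Prop :=
  [/\ L2 u, L2 w &
      forall phi, test_fun phi ->
        \int[mu_L]_t (u t * derive1n k phi t) =
        (-1) ^+ k * \int[mu_L]_t (w t * phi t)].

(* Elements of H^n are represented by functions; two functions that are equal
   almost everywhere represent the same element. *)
Definition sobolev (n : nat) : set (R -> R) := [set u |
  forall k, (k <= n)%N -> exists w, is_weak_derive k u w].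

(* A representative of u^(k): weak derivatives are unique only up to almost
   everywhere equality, and [weak_derive 0 u] is almost everywhere u. *)
Definition weak_derive (k : nat) u : R -> R :=
  xget (cst 0) [set w | is_weak_derive k u w].

Definition sobolev_inner (n : nat) u v : R :=
  \sum_(k < n.+1) \int[mu_L]_t (weak_derive k u t * weak_derive k v t).

Definition sobolev_norm (n : nat) u : R := Num.sqrt (sobolev_inner n u u).

Definition C0 : set (R -> R) := [set f |
  [/\ continuous f, f x @[x --> +oo] --> (0 : R) &
      f x @[x --> -oo] --> (0 : R)]].

Definition sup_norm f : \bar R := ereal_sup [set `|f x|%:E | x in [set: R]].

Definition conv f g : R -> R := fun x => \int[mu_L]_t (f (x - t) * g t).

End function_classes.

Section signed_measures.
Context {R : realType}.

(* The finite signed Radon measures on the real line: every finite signed Borel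
   measure is Radon there. *)
Definition signed_measure : Type := {charge set (measurableTypeR R) -> \bar R}.

Implicit Types (mu : signed_measure) (f : R -> R).

(* The integral with respect to mu^+ - mu^-. The measures mu^+ and mu^- do not
   depend on the Hahn decomposition that is chosen. *)
Definition signed_integral mu f : R :=
  let hahn := projT2 (cid (projT2 (cid (Hahn_decomposition mu)))) in
  \int[jordan_pos hahn]_y f y - \int[jordan_neg hahn]_y f y.

Definition conv_measure f mu : R -> R :=
  fun x => signed_integral mu (fun y => f (x - y)).

End signed_measures.
Arguments signed_measure : clear implicits.

Section operators.
Context {R : realType}.
Implicit Types (G u v : R -> R) (T : (R -> R) -> (R -> R)).

Definition conv_op (n : nat) G u : R -> R := fun x =>
  \sum_(k < n.+1) (-1) ^+ k * conv (derive1n k G) (weak_derive k u) x.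

(* The following notions concern operators T from H^n to C0. *)

(* T takes the same value on all representatives of an element of H^n *)
Definition respects_ae (n : nat) T : Prop :=
  forall u v, sobolev n u -> ae_eq mu_L setT u v -> T u = T v.

Definition linear_on_sobolev (n : nat) T : Prop :=
  forall (a : R) u v, sobolev n u -> sobolev n v ->
    T (a *: u + v) = a *: T u + T v.

Definition bounded_op (n : nat) T : Prop :=
  exists C : R, forall u, sobolev n u ->
    (sup_norm (T u) <= (C * sobolev_norm n u)%:E)%E.

Definition op_norm (n : nat) T : \bar R :=
  ereal_sup [set sup_norm (T u) | u in
    [set u | sobolev n u /\ sobolev_norm n u <= 1]].

(* The dual map sends mu, seen as a functional on C0, to a functional on H^n *)
Definition dual_map T (mu : signed_measure R) : (R -> R) -> R :=
  fun u => signed_integral mu (T u).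

(* The element v of H^n is identified with the functional L on H^n *)
Definition riesz_represents (n : nat) v (L : (R -> R) -> R) : Prop :=
  sobolev n v /\ forall u, sobolev n u -> sobolev_inner n v u = L u.

End operators.

(* Main.v *)
Require Import Defs.
From HB Require Import structures.
From mathcomp Require Import all_boot all_order all_algebra.
From mathcomp Require Import all_classical all_reals all_analysis.
From mathcomp Require Import lra measurable_realfun.
Import Order.TTheory GRing.Theory Num.Theory.
Import numFieldNormedType.Exports.
Local Open Scope classical_set_scope.
Local Open Scope ring_scope.
Set Implicit Arguments.
Unset Strict Implicit.
Unset Printing Implicit Defensive.

(* The kernels G^(k) are, up to null sets, bounded and integrable, so integration
   by parts (the fundamental theorem of calculus for absolutely continuous
   functions) makes them the weak derivatives of G, and those of G_(x) are
   (-1)^k G^(k)(x - t). This identifies T u(x) with the inner product of G_(x) and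
   u. Convolving a bounded integrable function with a square integrable one gives
   an element of C_0. By Cauchy-Schwarz and translation invariance |T u(x)| is at
   most |G| |u|, with equality for u = G / |G| and x = 0, because G_(0) = G by
   evenness. By Fubini, G * mu has the weak derivatives G^(k) * mu, and its inner
   product with u is the integral of T u with respect to mu; it is the only such
   element of H^n since the inner product is definite. *)

(** * Integrals *)

Import HBNNSimple.

(** Two mismatches shape the proof. First, measurability means Borel measurability, while elements
    of [L2], and [derive1n n G] itself, are only almost everywhere equal to Borel functions. The
    integral is defined for arbitrary functions through suprema over simple functions, so its
    invariance under almost everywhere equality is proved without measurability; computations then
    pass to bounded integrable Borel kernels [f k] and square integrable Borel representatives
    [U k]. Second, [mu] may charge Lebesgue null sets, for instance through an atom. Replacing [G]
    by a representative may therefore change [conv_measure G mu] at some points, though by Tonelli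
    only on a null set, and identities that are integrated against [mu] must hold for every [y]. The
    fundamental theorem of calculus is derived from the epsilon-delta definition: absolute
    continuity passes to the variation, nondecreasing functions define Stieltjes measures dominated
    by the Lebesgue measure, and Radon-Nikodym supplies the density. *)

Lemma ge0_ae_le_integralT d (T : measurableType d) (R : realType)
    (mu : {measure set T -> \bar R}) (f g : T -> \bar R) :
  (forall x, 0 <= f x)%E -> (forall x, 0 <= g x)%E ->
  (\forall x \ae mu, (f x <= g x)%E) ->
  (\int[mu]_x f x <= \int[mu]_x g x)%E.
Proof.
move=> f0 g0 [N [mN N0 fgN]].
rewrite (ge0_integralTE mu f0); apply: ge_ereal_sup => _ [h /= hf <-].
have mCN := measurableC mN.
(* [h'] is [h] set to zero on the null set [N] that contains all exceptional points: its integral is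
   that of [h], and it lies below [g] everywhere. *)
pose h' := proj_nnsfun h mCN.
have h'E x : h' x = h x * (x \in ~` N)%:R by rewrite /h' /= /mindic indicE mulrC.
have -> : sintegral mu h = sintegral mu h'.
  rewrite -!integralT_nnsfun; apply: ge0_ae_eq_integral => //.
  - exact/measurable_EFinP.
  - exact/measurable_EFinP.
  - by move=> x _; rewrite lee_fin.
  - by move=> x _; rewrite lee_fin.
  exists N; split=> // x; apply: contra_notP => xN _.
  by congr EFin; rewrite h'E mem_set// mulr1.
have h'g x : ((h' x)%:E <= g x)%E.
  rewrite h'E; have [xN|xN] := pselect (N x).
    by rewrite memNset ?mulr0//; exact.
  rewrite mem_set// mulr1 (le_trans (hf x))//.
  by apply: contra_notT xN => fg; apply: fgN => /=; exact/negP.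
by rewrite (ge0_integralTE mu g0); apply: ereal_sup_ubound; exists h'.
Qed.

Lemma ae_eq_integralT d (T : measurableType d) (R : realType)
    (mu : {measure set T -> \bar R}) (f g : T -> \bar R) :
  (ae_eq mu setT f g -> \int[mu]_x f x = \int[mu]_x g x)%E.
Proof.
move=> /ae_eq_funeposneg[fg fg'].
rewrite integralE [in RHS]integralE; congr (_ - _)%E.
- by apply/eqP; rewrite eq_le; apply/andP; split;
    apply: ge0_ae_le_integralT => //; apply: filterS fg => x /(_ I) ->.
- by apply/eqP; rewrite eq_le; apply/andP; split;
    apply: ge0_ae_le_integralT => //; apply: filterS fg' => x /(_ I) ->.
Qed.

Lemma ae_lebesgue_mono (R : realType) (P Q : R -> Prop) :
  (\forall x \ae (@mu_L R), P x) -> (forall x, P x -> Q x) ->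
  \forall x \ae (@mu_L R), Q x.
Proof. by move=> [N [mN N0 PN]] PQ; exists N; split=> // x nQ; apply: PN => /PQ. Qed.

Lemma ae_lebesgue_mono2 (R : realType) (P Q S : R -> Prop) :
  (\forall x \ae (@mu_L R), P x) -> (\forall x \ae (@mu_L R), Q x) ->
  (forall x, P x -> Q x -> S x) -> \forall x \ae (@mu_L R), S x.
Proof.
move=> aP aQ PQS; have := @filterI _ _ (ae_filter_ringOfSetsType (@mu_L R)) _ _ aP aQ.
by move/ae_lebesgue_mono; apply => x [Px /PQS]; exact.
Qed.

Lemma ae_eq_Rintegral d (T : measurableType d) (R : realType)
    (mu : {measure set T -> \bar R}) (f g : T -> R) :
  ae_eq mu setT f g -> \int[mu]_x f x = \int[mu]_x g x.
Proof.
move=> fg; congr fine; apply: ae_eq_integralT.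
by apply: filterS fg => x /(_ I) ->.
Qed.

Lemma eq_integrableT d (T : measurableType d) (R : realType)
    (mu : {measure set T -> \bar R}) (f g : T -> \bar R) :
  f =1 g -> mu.-integrable setT f -> mu.-integrable setT g.
Proof. by move=> /funext ->. Qed.

Lemma Rintegral_sum d (T : measurableType d) (R : realType)
    (mu : {measure set T -> \bar R}) (n : nat) (f : 'I_n -> T -> R) :
  (forall i, mu.-integrable setT (EFin \o f i)) ->
  \int[mu]_x (\sum_(i < n) f i x) = \sum_(i < n) \int[mu]_x f i x.
Proof.
move=> intf.
have H (s : seq 'I_n) : mu.-integrable setT (EFin \o (fun x => \sum_(i <- s) f i x)) /\
    \int[mu]_x (\sum_(i <- s) f i x) = \sum_(i <- s) \int[mu]_x f i x.
  elim: s => [|i s [IH1 IH2]].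
    split.
      by apply: eq_integrableT (integrable0 _ _) => // x /=; rewrite big_nil.
    rewrite big_nil -[RHS](mul0r (fine (mu setT))) -Rintegral_cst//.
    by apply: eq_Rintegral => x _; rewrite big_nil.
  split.
    apply: eq_integrableT (integrableD _ (intf i) IH1) => // x /=.
    by rewrite big_cons EFinD.
  rewrite big_cons -IH2 -RintegralD//.
  by apply: eq_Rintegral => x _; rewrite big_cons.
by have [_] := H (index_enum 'I_n).
Qed.

(** * Borel square integrable functions *)

(** Membership in [Lfun] at exponent 2, freed of extended real powers. By [L2P] these are the Borel
    representatives of the elements of [L2]. *)
Definition sqint (R : realType) (f : R -> R) : Prop :=
  measurable_fun setT f /\ mu_L.-integrable setT (EFin \o (fun x => f x ^+ 2)).

Lemma L2P (R : realType) (u : R -> R) :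
  L2 u <-> exists2 v, sqint v & ae_eq mu_L setT u v.
Proof.
split=> [[v v2 uv]|[v [mv v2] uv]]; exists v => //.
  split; last exact: Lfun2_integrable_sqr.
  by move: v2; rewrite inE => /andP[/[!inE]].
rewrite inE; apply/andP; split; rewrite inE//=.
move/integrableP : v2 => [_ v2].
rewrite /finite_norm unlock; apply: poweR_lty.
apply: le_lt_trans v2; apply: ge0_le_integral => //.
- by move=> x _; exact: poweR_ge0.
- by apply: (measurableT_comp (measurable_poweR _)) => //;
    apply: measurableT_comp => //; exact/measurable_EFinP.
- apply: measurableT_comp => //; apply/measurable_EFinP.
  exact: measurable_funX.
- by move=> x _ /=; rewrite lee_fin normrX powR_mulrn.
Qed.

(** Domination by [f ^+ 2 + g ^+ 2], which follows from the squares of [f + g] and [f - g]. *)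
Lemma sqint_mul (R : realType) (f g : R -> R) : sqint f -> sqint g ->
  mu_L.-integrable setT (EFin \o (fun x => f x * g x)).
Proof.
move=> [mf f2] [mg g2].
apply: le_integrable (integrableD _ f2 g2) => //.
  by apply/measurable_EFinP; exact: measurable_funM.
move=> x _ /=; rewrite lee_fin [leRHS]ger0_norm ?addr_ge0 ?sqr_ge0//.
rewrite ler_norml; have := sqr_ge0 (f x - g x); have := sqr_ge0 (f x + g x).
have := sqr_ge0 (f x); have := sqr_ge0 (g x).
by move=> h1 h2 h3 h4; apply/andP; split; lra.
Qed.

Lemma sqintD (R : realType) (f g : R -> R) : sqint f -> sqint g ->
  sqint (fun x => f x + g x).
Proof.
move=> hf hg; move: (hf) (hg) => [mf f2] [mg g2]; split.
  exact: measurable_funD.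
have := integrableD measurableT (integrableD measurableT f2 g2)
  (integrableZl measurableT 2 (sqint_mul hf hg)).
apply: eq_integrableT => x /=; rewrite -!EFinD; congr EFin; lra.
Qed.

Lemma sqintZ (R : realType) (a : R) (f : R -> R) : sqint f ->
  sqint (fun x => a * f x).
Proof.
move=> [mf f2]; split; first exact: measurable_funM.
apply: eq_integrableT (integrableZl measurableT (a ^+ 2) f2) => x /=.
by rewrite exprMn.
Qed.

Lemma sqint0 (R : realType) : sqint (cst 0 : R -> R).
Proof.
split => //; apply: eq_integrableT (integrable0 _ _) => // x /=.
by rewrite expr0n.
Qed.

(** Since [f ^+ 2] is at most [M * |f|]. This is how the kernels enter L2. *)
Lemma bounded_sqint (R : realType) (f : R -> R) (M : R) :
  (forall x, `|f x| <= M) -> mu_L.-integrable setT (EFin \o f) -> sqint f.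
Proof.
move=> fM intf; have mf : measurable_fun setT f.
  by apply/measurable_EFinP; exact: measurable_int intf.
split=> //; apply: (le_integrable _ _ _ (integrableZl measurableT M intf)) => //.
  by apply/measurable_EFinP; exact: measurable_funX.
move=> x _ /=; rewrite lee_fin expr2 !normrM ler_wpM2r//.
by rewrite (le_trans (fM x))// ler_norm.
Qed.

(** * Invariance of the Lebesgue integral under reflections *)

Lemma measurable_reflect (R : realType) (x : R) :
  measurable_fun [set: measurableTypeR R] ((fun t => x - t) : measurableTypeR R -> measurableTypeR R).
Proof. by apply: measurable_funB. Qed.

(** Lebesgue measure is determined by its values on the intervals []a, b]]. Their preimages are
    half-open on the other side but have the same length. *)
Lemma lebesgue_measure_reflect (R : realType) (x : R) (A : set R) :
  measurable A ->
  pushforward mu_L ((fun t => x - t) : R -> measurableTypeR R) A = mu_L A.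
Proof.
move=> mA; apply/esym/lebesgue_measure_unique => //=.
  exact: measurable_reflect.
move=> _ _ [[a b]] _ <-.
rewrite /pushforward /=.
have -> : (fun t => x - t) @^-1` `]a, b]%classic = `[x - b, x - a[%classic.
  apply/seteqP; split=> t /=; rewrite !in_itv/= => /andP[? ?]; apply/andP; split; lra.
rewrite !lebesgue_measure_itv/= !lte_fin.
have -> : (x - b < x - a) = (a < b) by rewrite ltrD2l ltrN2.
case: ifP => // _; rewrite -!EFinB; congr EFin; lra.
Qed.

Lemma ae_reflect (R : realType) (x : R) (P : R -> Prop) :
  (\forall t \ae (@mu_L R), P t) -> \forall t \ae (@mu_L R), P (x - t).
Proof.
move=> [N [mN N0 PN]]; exists ((fun t => x - t) @^-1` N); split.
- by rewrite -[X in measurable X]setTI; exact: measurable_reflect.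
- by rewrite -N0; exact: lebesgue_measure_reflect.
- by move=> t /= nP; exact: PN.
Qed.

Lemma ge0_integral_reflect (R : realType) (x : R) (f : R -> \bar R) :
  measurable_fun setT f -> (forall t, 0 <= f t)%E ->
  (\int[mu_L]_t f (x - t)%R = \int[mu_L]_t f t)%E.
Proof.
move=> mf f0.
transitivity (\int[pushforward mu_L ((fun t => (x - t)%R) : measurableTypeR R -> measurableTypeR R)]_t f t)%E.
  by rewrite (ge0_integral_pushforward (measurable_reflect x)).
apply: eq_measure_integral; first exact: measurable_reflect.
by move=> ? A mA _; exact: lebesgue_measure_reflect.
Qed.

Lemma Rintegral_reflect (R : realType) (x : R) (f : R -> R) :
  measurable_fun setT f -> \int[mu_L]_t f (x - t) = \int[mu_L]_t f t.
Proof.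
move=> mf; congr fine; rewrite integralE [in RHS]integralE.
have mf' : measurable_fun setT (fun t => (f t)%:E) by exact/measurable_EFinP.
rewrite -(ge0_integral_reflect x (measurable_funepos mf') (funepos_ge0 _)).
rewrite -(ge0_integral_reflect x (measurable_funeneg mf') (funeneg_ge0 _)).
by congr (_ - _)%E; apply: eq_integral => t _; rewrite ?funeposE ?funenegE.
Qed.

Lemma integrable_reflect (R : realType) (x : R) (f : R -> R) :
  mu_L.-integrable setT (EFin \o f) ->
  mu_L.-integrable setT (EFin \o (fun t => f (x - t))).
Proof.
move=> /integrableP[mf fi]; apply/integrableP; split.
  exact: (measurableT_comp mf (measurable_reflect x)).
by rewrite (@ge0_integral_reflect _ x (fun t => `|(f t)%:E|%E))//; exact: measurableT_comp.
Qed.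

Lemma sqint_reflect (R : realType) (x : R) (f : R -> R) :
  sqint f -> sqint (fun t => f (x - t)).
Proof.
move=> [mf f2]; split; first exact: (measurableT_comp mf (measurable_reflect x)).
exact: (integrable_reflect x f2).
Qed.

(** * The Cauchy-Schwarz inequality *)

Lemma ge0_quadratic_discriminant (R : realFieldType) (a b c : R) :
  (forall t, 0 <= t ^+ 2 * a + 2 * t * b + c) -> b ^+ 2 <= a * c.
Proof.
move=> h; have a0 : 0 <= a.
  rewrite leNgt; apply/negP => a0.
  (* If [a < 0], the quadratic is negative far out. This [t] makes [- (t * a)] exceed all the lower
     order coefficients, and [t + 1] is far enough. *)
  pose t := (1 + `|b| *+ 2 + `|c|) / - a.
  have ta : - (t * a) = 1 + `|b| *+ 2 + `|c| by rewrite /t -mulrN mulrVK// unitfE; lra.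
  have t0 : 0 <= t by rewrite /t divr_ge0 ?addr_ge0 ?mulrn_wge0//; lra.
  have := h (t + 1).
  have := ler_norm b; have := ler_norm c; have := normr_ge0 b; have := normr_ge0 c.
  have tb : t * b <= t * `|b| by rewrite ler_wpM2l// ler_norm.
  have -> : (t + 1) ^+ 2 * a = (t + 1) * (t * a) + t * a + a by lra.
  have -> : t * a = - (1 + `|b| *+ 2 + `|c|) by lra.
  have tc : 0 <= t * `|c| by rewrite mulr_ge0.
  by move=> *; lra.
have [a0'|an0] := eqVneq a 0; last first.
  have bE : b = b / a * a by rewrite divfK.
  (* The minimum of the quadratic is attained at [- (b / a)]. *)
  have := h (- (b / a)); set d := b / a in bE *.
  rewrite bE => h1; have h2 : 0 <= c - d ^+ 2 * a by lra.
  by have := mulr_ge0 a0 h2; lra.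
rewrite a0' mul0r; have [->|b0] := eqVneq b 0; first by rewrite expr0n.
(* For [a = 0] and [b] nonzero, the point below makes the linear term [- (c + 1)], so that the value
   is [- 1]. *)
have eb : (c + 1) * (b^-1 * b) = c + 1 by rewrite mulVf ?mulr1.
have := h (- (c + 1) * b^-1 / 2); rewrite a0' mulr0; lra.
Qed.

(** The discriminant of the squared norm of [t f + g], a quadratic in [t]. Families are needed
    because the Sobolev inner product sums over derivatives; a single pair is the case of L2. *)
Lemma cauchy_schwarz_sum (R : realType) (n : nat) (f g : 'I_n -> R -> R) :
  (forall i, sqint (f i)) -> (forall i, sqint (g i)) ->
  `|\sum_(i < n) \int[mu_L]_x (f i x * g i x)| <=
  Num.sqrt (\sum_(i < n) \int[mu_L]_x (f i x * f i x)) *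
  Num.sqrt (\sum_(i < n) \int[mu_L]_x (g i x * g i x)).
Proof.
move=> hf hg; set a := \sum_(i < n) \int[mu_L]_x (f i x * g i x).
set b := \sum_(i < n) \int[mu_L]_x (f i x * f i x).
set c := \sum_(i < n) \int[mu_L]_x (g i x * g i x).
have ge0 (h : 'I_n -> R -> R) : 0 <= \sum_(i < n) \int[mu_L]_x (h i x * h i x).
  by apply: sumr_ge0 => i _; apply: Rintegral_ge0 => x _; rewrite -expr2 sqr_ge0.
rewrite -sqrtrM ?ge0// -sqrtr_sqr ler_wsqrtr//.
apply: ge0_quadratic_discriminant => t.
have := ge0 (fun i x => t * f i x + g i x).
suff -> : \sum_(i < n) \int[mu_L]_x ((t * f i x + g i x) * (t * f i x + g i x)) =
  t ^+ 2 * b + 2 * t * a + c by [].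
rewrite /a /b /c !mulr_sumr -!big_split/=; apply: eq_bigr => i _.
rewrite -RintegralZl ?sqint_mul// -RintegralZl ?sqint_mul//.
rewrite -RintegralD//; last 2 first.
- exact: (integrableZl measurableT _ (sqint_mul (hf i) (hf i))).
- exact: (integrableZl measurableT _ (sqint_mul (hf i) (hg i))).
rewrite -RintegralD//; last 2 first.
- exact: (integrableD measurableT
    (integrableZl measurableT (t ^+ 2) (sqint_mul (hf i) (hf i)))
    (integrableZl measurableT (2 * t) (sqint_mul (hf i) (hg i)))).
- exact: sqint_mul.
by apply: eq_Rintegral => x _; lra.
Qed.

(** * Smooth functions *)

Definition smooth (R : realType) (f : R -> R) : Prop :=
  forall k x, derivable (derive1n k f) x 1.

Lemma smooth_derive1 (R : realType) (f : R -> R) : smooth f -> smooth f^`()%classic.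
Proof. by move=> sf k x; rewrite -derive1Sn; exact: sf. Qed.

Lemma smooth_derive1n (R : realType) (f : R -> R) k : smooth f -> smooth (derive1n k f).
Proof. by elim: k => // k IH sf; rewrite derive1nS; apply/smooth_derive1/IH. Qed.

Lemma smooth_derivable (R : realType) (f : R -> R) x : smooth f -> derivable f x 1.
Proof. by move/(_ 0). Qed.

Lemma smooth_continuous (R : realType) (f : R -> R) : smooth f -> continuous f.
Proof.
by move=> sf x; apply/differentiable_continuous/derivable1_diffP/smooth_derivable.
Qed.

(** Coinduction for smoothness: iterated derivatives never leave [P]. *)
Lemma smooth_coind (R : realType) (P : (R -> R) -> Prop) :
  (forall f, P f -> (forall x, derivable f x 1) /\ P f^`()%classic) ->
  forall f, P f -> smooth f.
Proof.
move=> PP f Pf; have Pfk k : P (derive1n k f).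
  by elim: k => // k /PP[_]; rewrite derive1nS.
by move=> k x; have [] := PP _ (Pfk k).
Qed.

(* A class that contains the smooth functions and, unlike smoothness itself, is
   visibly closed under both the operations below and differentiation. *)
Inductive smooth_gen (R : realType) : (R -> R) -> Prop :=
| smooth_gen_base f : smooth f -> smooth_gen f
| smooth_gen_add f g : smooth_gen f -> smooth_gen g ->
    smooth_gen (fun x => f x + g x)
| smooth_gen_mul f g : smooth_gen f -> smooth_gen g ->
    smooth_gen (fun x => f x * g x)
| smooth_gen_comp f g : smooth_gen f -> smooth_gen g ->
    smooth_gen (fun x => f (g x)).

Lemma smooth_gen_smooth (R : realType) (f : R -> R) : smooth_gen f -> smooth f.
Proof.
apply: smooth_coind => {}f; elim=> {f} [f sf|f g _ [df f'] _ [dg g']|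
    f g gf [df f'] gg [dg g']|f g gf [df f'] gg [dg g']].
- by split=> [x|]; [exact: smooth_derivable|exact/smooth_gen_base/smooth_derive1].
- split=> [x|]; first exact: (derivableD (df x) (dg x)).
  rewrite (_ : _^`()%classic = (fun x => f^`()%classic x + g^`()%classic x)); first exact: smooth_gen_add.
  apply/funext => x; rewrite !derive1E.
  exact: (deriveD (df x) (dg x)).
- split=> [x|]; first exact: (derivableM (df x) (dg x)).
  rewrite (_ : _^`()%classic = (fun x => f x * g^`()%classic x + g x * f^`()%classic x)).
    by apply: smooth_gen_add; exact: smooth_gen_mul.
  apply/funext => x; rewrite !derive1E.
  exact: (deriveM (df x) (dg x)).
- have H (x : R) : is_derive x 1 (f \o g) (f^`()%classic (g x) * g^`()%classic x).
    have d1 : is_derive (g x) 1 f (f^`()%classic (g x)).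
      by rewrite derive1E; exact/derivableP.
    have d2 : is_derive x 1 g (g^`()%classic x) by rewrite derive1E; exact/derivableP.
    exact: is_derive1_comp.
  split=> [x|]; first by have [] := H x.
  rewrite (_ : _^`()%classic = (fun x => f^`()%classic (g x) * g^`()%classic x)).
    by apply: smooth_gen_mul => //; exact: smooth_gen_comp.
  by apply/funext => x; rewrite derive1E; have [_] := H x.
Qed.

Lemma smoothM (R : realType) (f g : R -> R) : smooth f -> smooth g ->
  smooth (fun x => f x * g x).
Proof.
by move=> sf sg; apply/smooth_gen_smooth/smooth_gen_mul; exact: smooth_gen_base.
Qed.

Lemma smooth_cst (R : realType) (c : R) : smooth (fun _ : R => c).
Proof.
apply: (@smooth_coind _ (fun f => exists c, f = cst c)); last by exists c.
move=> _ [d ->]; split; first by move=> x; exact: derivable_cst.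
by exists 0; apply/funext => x; rewrite derive1_cst.
Qed.

Lemma smooth_affine (R : realType) (f : R -> R) (c d : R) : smooth f ->
  smooth (fun x => f (c * x + d)).
Proof.
move=> sf; apply/smooth_gen_smooth.
apply: (@smooth_gen_comp _ f (fun x => c * x + d)); first exact: smooth_gen_base.
apply: smooth_gen_add; last exact/smooth_gen_base/smooth_cst.
apply: smooth_gen_mul; first exact/smooth_gen_base/smooth_cst.
apply: smooth_gen_base => k x; case: k => [|k]; first exact: derivable_id.
rewrite derive1Sn (_ : (fun x => x)^`()%classic = cst 1).
  exact: smooth_cst.
by apply/funext => y; rewrite derive1_id.
Qed.

(* The factor [y ^+ n] makes the induction over [p] go through. *)
Lemma poly_expRN_bounded (R : realType) (p : {poly R}) (n : nat) :
  exists C : R, forall y, 0 < y -> `|p.[y]| * y ^+ n * expR (- y) <= C.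
Proof.
have M m (y : R) : 0 < y -> y ^+ m * expR (- y) <= (m`!)%:R.
  move=> y0; rewrite expRN ler_pdivrMr ?expR_gt0//.
  case: m => [|m]; first by rewrite expr0 fact0 mul1r ltW// expR_gt1.
  have m0 : 0 < ((m.+1)`!%:R : R) by rewrite ltr0n fact_gt0.
  rewrite mulrC -ler_pdivrMr//; apply: le_trans (expR_ge1Dxn m (ltW y0)).
  by rewrite lerDr.
elim/poly_ind: p n => [|p c IH] n.
  by exists 0 => y _; rewrite horner0 normr0 !mul0r.
have [C1 H1] := IH n.+1.
exists (C1 + `|c| * (n`!)%:R) => y y0; rewrite hornerD hornerM hornerX hornerC.
have := H1 y y0; have := M n y y0.
have e0 : 0 <= y ^+ n * expR (- y) by rewrite mulr_ge0 ?exprn_ge0 ?ltW// expR_gt0.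
move=> h1 h2; rewrite -mulrA.
apply: (@le_trans _ _ ((`|p.[y] * y| + `|c|) * (y ^+ n * expR (- y)))).
  by rewrite ler_wpM2r// ler_normD.
rewrite mulrDl lerD ?ler_wpM2l//.
by apply: le_trans h2; rewrite normrM (ger0_norm (ltW y0)) exprS !mulrA.
Qed.

(** For [p = 1] this is the classical smooth function that vanishes to infinite order at 0. The
    polynomial factor makes the family closed under differentiation. *)
Definition flat (R : realType) (p : {poly R}) (x : R) : R :=
  if 0 < x then p.[x^-1] * expR (- x^-1) else 0.

(** With [y = x^-1], differentiation in [x] is [- y ^+ 2] times differentiation in [y], which sends
    [p(y) exp(-y)] to [y ^+ 2 (p - p')(y) exp(-y)] for [x > 0]. The point 0 needs a growth
    estimate. *)
Lemma is_derive_flat (R : realType) (p : {poly R}) (x : R) :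
  is_derive x 1 (flat p) (flat ('X^2 * (p - p^`())) x).
Proof.
have [x0|x0|->] := ltgtP x 0.
- rewrite /flat ltNge ltW//=.
  apply: (@near_eq_is_derive _ _ _ (cst 0)).
    near=> y; rewrite /flat ltNge ltW//=.
    by near: y; exact: lt_nbhsl.
- rewrite /flat x0.
  apply: (@near_eq_is_derive R R R (fun x : R => p.[x^-1] * expR (- x^-1))).

    near=> y; rewrite /flat ifT//.
    by near: y; exact: lt_nbhsr.
  have dV : is_derive x 1 (fun y : R => y^-1) (- x ^- 2 *: 1).
    by apply: is_deriveV; exact: lt0r_neq0.
  have dp : is_derive x^-1 1 (fun y => p.[y]) p^`().[x^-1] by exact: is_derive_poly.
  have d1 := is_derive1_comp dp dV.
  have dN : is_derive x 1 (fun y : R => - y^-1) (- (- x ^- 2 *: 1)) by exact: is_deriveN.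
  have d2 := @is_derive1_comp R expR (fun y => - y^-1) x _ _ (is_derive_expR (- x^-1)) dN.
  have := is_deriveM d1 d2.
  set v := (X in is_derive _ _ _ X -> _); set w := (X in _ -> is_derive _ _ _ X).
  suff -> : v = w by exact.
  rewrite /v /w /= !hornerE /=.
  rewrite exprVn /GRing.scale/=; lra.
- rewrite /flat ltxx.
  (* Exponent 2 bounds [flat p h] by a multiple of [h ^+ 2], so that the difference quotient at 0 is
     of order [h]. *)
  have [C HC] := poly_expRN_bounded p 2.
  have fC h : `|flat p h| <= C * h ^+ 2.
    rewrite /flat; case: ifPn => h0; last first.
      have := HC 1 ltr01; rewrite normr0 => H; apply: mulr_ge0 (sqr_ge0 _).
      by apply: le_trans H; rewrite !mulr_ge0 ?expR_ge0// exprn_ge0.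
    have hV : 0 < h^-1 by rewrite invr_gt0.
    have := HC _ hV; rewrite normrM (ger0_norm (expR_ge0 _)).
    rewrite -ler_pdivrMr ?exprn_gt0//; apply: le_trans.
    by rewrite exprVn mulrAC.
  have C0 : 0 <= C by have := le_trans (normr_ge0 _) (fC 1); rewrite expr1n mulr1.
  have f0 : flat p 0 = 0 by rewrite /flat ltxx.
  have cv : h^-1 *: (flat p (h *: 1 + 0) - flat p 0) @[h --> 0^'] --> (0 : R).
    rewrite f0; apply/cvgrPdist_lt => e e0; near=> h.
    have h0 : h != 0 by near: h; exact: nbhs_dnbhs_neq.
    rewrite sub0r normrN subr0 addr0 /GRing.scale/= mulr1 normrM normfV.
    rewrite mulrC ltr_pdivrMr ?normr_gt0//.
    apply: le_lt_trans (fC h) _.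
    rewrite -(ger0_norm (sqr_ge0 h)).
    rewrite normrX expr2 mulrA ltr_pM2r ?normr_gt0//.
    (* [C] may be 0, whereas [C + 1] can be divided by. *)
    apply: (@le_lt_trans _ _ ((C + 1) * `|h|)); first by rewrite ler_wpM2r// lerDl.
    rewrite mulrC -ltr_pdivlMr ?ltr_wpDl//.
    near: h; apply: dnbhs0_lt; by rewrite divr_gt0// ltr_wpDl.
  apply: DeriveDef; last exact: cvg_lim cv.
  by apply/cvg_ex; exists 0.
Unshelve. all: by end_near. Qed.

Lemma smooth_flat (R : realType) (p : {poly R}) : smooth (flat p).
Proof.
apply: (@smooth_coind _ (fun f => exists p, f = flat p)); last by exists p.
move=> _ [q ->]; split; first by move=> x; have [] := is_derive_flat q x.
exists ('X^2 * (q - q^`())); apply/funext => x.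
by rewrite derive1E; have [_] := is_derive_flat q x.
Qed.

(** * Test functions and the fundamental lemma of the calculus of variations *)

Lemma test_funP (R : realType) (phi : R -> R) :
  test_fun phi <-> smooth phi /\ exists N : R, forall x, N < `|x| -> phi x = 0.
Proof.
split=> [[sp cp]|[sp [N HN]]]; split => //.
  have [M [_ HM]] := compact_bounded cp.
  exists (`|M| + 1) => x Mx; apply: contrapT => /eqP px.
  have := HM (`|M| + 1); rewrite (le_lt_trans (ler_norm _)) ?ltrDl// => /(_ isT x).
  by move=> /(_ (@subset_closure _ [set x | phi x != 0] x px)) /=; rewrite leNgt Mx.
apply: (@subclosed_compact _ _ `[- N, N]%classic).
- exact: closed_closure.
- exact: segment_compact.
- rewrite [X in _ `<=` X](closure_id _).1; last exact: itv_closed.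
  apply: closure_subset => x /= /eqP px; rewrite in_itv/= -ler_norml.
  by rewrite leNgt; apply/negP => /HN.
Qed.

Lemma derive1n_eq0 (R : realType) (phi : R -> R) (N : R) k :
  (forall x, N < `|x| -> phi x = 0) -> forall x, N < `|x| -> derive1n k phi x = 0.
Proof.
move=> HN; elim: k => // k IH x Nx; rewrite derive1nS derive1E.
transitivity ('D_1 (cst 0 : R -> R) x); last by rewrite derive_cst.
apply: (@near_eq_derive R R R); near=> y; apply: IH; near: y.
have : {for x, continuous (fun y : R => `|y|)} by exact: norm_continuous.
by move=> /cvgr_gt; apply.
Unshelve. all: by end_near. Qed.

Lemma test_fun_derive1n (R : realType) (phi : R -> R) k :
  test_fun phi -> test_fun (derive1n k phi).
Proof.
move=> /test_funP[sp [N HN]]; apply/test_funP; split; first exact: smooth_derive1n.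
by exists N; exact: derive1n_eq0.
Qed.

Lemma test_fun_bounded (R : realType) (phi : R -> R) :
  test_fun phi -> exists2 M, 0 < M & forall x, `|phi x| <= M.
Proof.
move=> /test_funP[/smooth_continuous cp [N HN]].
have := @compact_bounded _ _ _ (continuous_compact (continuous_subspaceT cp) (@segment_compact R (- N) N)).
move=> [M [_ HM]]; exists (`|M| + 1); first by rewrite ltr_wpDl.
move=> x; have [Nx|xN] := ltP N `|x|.
  by rewrite HN// normr0 addr_ge0.
apply: HM; first by rewrite (le_lt_trans (ler_norm _))// ltrDl.
by exists x => //=; rewrite in_itv/= -ler_norml.
Qed.

Lemma test_fun_integrable (R : realType) (phi : R -> R) :
  test_fun phi -> mu_L.-integrable setT (EFin \o phi).
Proof.
move=> /test_funP[/smooth_continuous cp [N HN]].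
have H : mu_L.-integrable `[- N, N] (EFin \o phi).
  apply: continuous_compact_integrable; first exact: segment_compact.
  exact: continuous_subspaceT.
apply: eq_integrableT ((integrable_mkcond _ _).1 H); last exact: measurable_itv.
move=> x; rewrite patchE; case: ifPn => //; rewrite notin_setE/= in_itv/= -ler_norml.
by move/negP; rewrite -ltNge => /HN ->.
Qed.

Lemma test_fun_sqint (R : realType) (phi : R -> R) : test_fun phi -> sqint phi.
Proof.
move=> tp; have [M _ HM] := test_fun_bounded tp.
exact: bounded_sqint HM (test_fun_integrable tp).
Qed.

(** [|w|] is at most [w ^+ 2 + 1], and constants are integrable on a set of finite measure. *)
Lemma sqint_integrable_on (R : realType) (w : R -> R) (A : set (measurableTypeR R)) :
  measurable A -> (mu_L A < +oo)%E -> sqint w -> mu_L.-integrable A (EFin \o w).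
Proof.
move=> mA Afin [mw w2].
have w2A : mu_L.-integrable A (EFin \o (fun x => w x ^+ 2)).
  by apply: integrableS w2.
have i1 : mu_L.-integrable A (cst 1%E).
  apply/integrableP; split => //.
  by under eq_integral do rewrite abse1; rewrite integral_cst// mul1e.
have := integrableD mA w2A i1.
apply: le_integrable => //.
  by apply/measurable_EFinP; exact: measurable_funTS.
move=> x _ /=; rewrite lee_fin [leRHS]ger0_norm ?addr_ge0 ?sqr_ge0//.
by rewrite -real_normK ?num_real//; have := sqr_ge0 (`|w x| - 1); have := sqr_ge0 `|w x|; lra.
Qed.

Lemma sqint_locally_integrable (R : realType) (w : R -> R) :
  sqint w -> locally_integrable setT w.
Proof.
move=> sw; split; [by case: sw|exact: openT|move=> K _ cK].
have mK : measurable K by exact: compact_measurable.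
have := sqint_integrable_on mK (compact_finite_measure cK) sw.
by case/integrableP.
Qed.

(** A smooth function that is positive exactly on []a, b[]. The dilation by [n.+1] drives both
    factors to 1 there, so that bumps converge to the indicator function. *)
Definition bump (R : realType) (a b : R) (n : nat) (x : R) : R :=
  flat 1 (n.+1%:R * (x - a)) * flat 1 (n.+1%:R * (b - x)).

Lemma flat1_ge0 (R : realType) (x : R) : 0 <= flat 1 x.
Proof. by rewrite /flat; case: ifP => // _; rewrite hornerC mul1r expR_ge0. Qed.

Lemma flat1_le1 (R : realType) (x : R) : flat 1 x <= 1.
Proof.
rewrite /flat; case: ifP => // x0; rewrite hornerC mul1r expR_le1 lerNl oppr0.
by rewrite invr_ge0 ltW.
Qed.

Lemma bump_le1 (R : realType) (a b : R) n x : `|bump a b n x| <= 1.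
Proof.
rewrite ger0_norm ?mulr_ge0 ?flat1_ge0//.
by rewrite mulr_ile1 ?flat1_ge0 ?flat1_le1.
Qed.

Lemma bump_out (R : realType) (a b : R) n x : x \notin `]a, b[ -> bump a b n x = 0.
Proof.
rewrite in_itv/= /bump /flat !pmulr_rgt0 ?ltr0n// !subr_gt0.
by case: (a < x) => /=; [move=> /negbTE ->; rewrite mulr0|rewrite mul0r].
Qed.

Lemma bump_test (R : realType) (a b : R) n : test_fun (bump a b n).
Proof.
apply/test_funP; split.
  apply: smoothM.
    rewrite (_ : (fun x => _) = fun x => flat 1 (n.+1%:R * x + - (n.+1%:R * a))).
      exact/smooth_affine/smooth_flat.
    by apply/funext => x; rewrite mulrBr.
  rewrite (_ : (fun x => _) = fun x => flat 1 (- n.+1%:R * x + (n.+1%:R * b))).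
    exact/smooth_affine/smooth_flat.
  by apply/funext => x; congr flat; lra.
exists (`|a| + `|b|) => x abx; apply: bump_out; rewrite in_itv/=.
apply/negP => /andP[ax xb]; move: abx; rewrite ltNge => /negP; apply.
rewrite ler_norml; have := ler_norm a; have := ler_norm b.
have := ler_norm (- a); rewrite normrN; have := ler_norm (- b); rewrite normrN.
by have := normr_ge0 a; have := normr_ge0 b; move=> *; apply/andP; split; lra.
Qed.

Lemma flat1_cvg (R : realType) (c : R) : 0 < c ->
  flat 1 (n.+1%:R * c) @[n --> \oo] --> (1 : R).
Proof.
move=> c0; rewrite [X in X @ _ --> _](_ : _ = fun n => expR (- (n.+1%:R^-1 * c^-1))).
  rewrite -[X in _ --> X](expR0 R) -oppr0 -(mul0r c^-1).
  apply: continuous_cvg; first exact: continuous_expR.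
  by apply: cvgN; apply: cvgMl; exact: cvg_harmonic.
apply/funext => n; rewrite /flat mulr_gt0 ?ltr0n// hornerC mul1r.
by rewrite invfM.
Qed.

Lemma bump_cvg (R : realType) (a b x : R) :
  bump a b n x @[n --> \oo] --> (\1_`]a, b[ x : R).
Proof.
rewrite indicE; have [xab|xab] := boolP (x \in `]a, b[).
  rewrite mem_set//= -[1%:R]mulr1.
  move: xab; rewrite in_itv/= => /andP[ax xb].
  by apply: cvgM; apply: flat1_cvg; rewrite subr_gt0.
rewrite memNset/=; last by move/negP : xab.
rewrite [X in X @ _ --> _](_ : _ = cst 0); first exact: cvg_cst.
by apply/funext => n; rewrite bump_out.
Qed.

(** Dominated convergence along bumps shows that [w] has integral 0 over every bounded open
    interval. Its indefinite integrals are then constant, and Lebesgue differentiation gives [w = 0]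
    almost everywhere. *)
Lemma fundamental_lemma (R : realType) (w : R -> R) : sqint w ->
  (forall phi, test_fun phi -> \int[mu_L]_x (w x * phi x) = 0) ->
  ae_eq mu_L setT w (cst 0).
Proof.
move=> sw wphi.
have mw : measurable_fun setT w by case: sw.
have w0 (a b : R) : (\int[mu_L]_(x in `]a, b[) (w x)%:E = 0)%E.
  have mab : measurable (`]a, b[%classic : set (measurableTypeR R)).
    exact: measurable_itv.
  have wi : mu_L.-integrable setT (EFin \o (w \_ `]a, b[)).
    have := sqint_integrable_on mab _ sw.
    rewrite lebesgue_measure_itv/=.
    have -> : ((if (a%:E < b%:E)%E then (b%:E - a%:E)%E else 0%E) < +oo)%E.
      by case: ifP => // _; rewrite -EFinB ltry.
    by move=> /(_ isT) /(integrable_mkcond _ mab); rewrite restrict_EFin.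
  pose f_ n x := (w x * bump a b n x)%:E.
  have [] := @dominated_convergence _ _ R mu_L setT measurableT f_
    (EFin \o (w \_ `]a, b[)) (fun x => `|(w \_ `]a, b[) x|%:E).
  - move=> n; apply/measurable_EFinP; apply: measurable_funM => //.
    by case: (test_fun_sqint (bump_test a b n)).
  - exact: measurable_int wi.
  - apply: aeW => x _; apply: cvg_EFin; first by near=> n.
    rewrite patchE; have := @bump_cvg R a b x; rewrite indicE.
    case: (x \in _) => /= h.
      by rewrite -[X in _ --> X]mulr1; apply: cvgMr.
    by rewrite -[X in _ --> X](mulr0 (w x)); apply: cvgMr.
  - exact: integrable_abse wi.
  - apply: aeW => x n _; rewrite /f_ /= lee_fin normrM patchE.
    case: ifPn => [_|]; first by rewrite ler_piMr// bump_le1.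
    rewrite notin_setE/= => /negP xab.
    by rewrite bump_out// normr0 mulr0.
  move=> _ _; rewrite (_ : [sequence _]_n = cst 0%E) => [h|].
    rewrite integral_mkcond restrict_EFin.
    by rewrite -(cvg_unique _ h (cvg_cst _)).
  apply/funext => n; have tb := bump_test a b n.
  rewrite -[LHS]fineK ?[fine _](wphi _ tb)//.
  by apply: integrable_fin_num => //; apply: sqint_mul => //; exact: test_fun_sqint.
(* [w] is only locally integrable, so the indefinite integral starts at a finite point [- N];
   countably many of these exhaust the line. *)
have H (N : nat) : {ae mu_L, forall x : R, - N%:R < x -> w x = 0}.
  have Fi y : mu_L.-integrable [set` Interval (BRight (- N%:R)) (BRight y)] (EFin \o w).
    have mNy : measurable ([set` Interval (BRight (- N%:R)) (BRight y)] : set (measurableTypeR R)).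
      exact: measurable_itv.
    apply: (sqint_integrable_on mNy) => //.
    rewrite lebesgue_measure_itv/=; case: ifP => // _.
    by rewrite -EFinB ltry.
  have := FTC1 Fi (sqint_locally_integrable sw).
  apply: filterS; first exact: (ae_filter_ringOfSetsType mu_L).
  move=> x /= Hx Nx; have /Hx[_ <-] : (BRight (- N%:R) < BRight x)%O by rewrite bnd_simp.
  rewrite (_ : (fun y => _) = cst 0) ?derive1_cst//.
  apply/funext => y; rewrite /Rintegral -integral_itv_bndo_bndc; last first.
    exact: measurable_funTS (measurableT_comp _ mw).
  by rewrite w0.
rewrite /ae_eq; apply: filterS (ae_foralln H) => x Hx _.
apply: (Hx (Num.truncn `|x|).+1).
rewrite ltrNl (le_lt_trans (ler_norm _))// normrN.
by rewrite truncnS_gt.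
Unshelve. all: by end_near. Qed.

(** * Absolutely continuous functions *)

(** Common endpoints are allowed, so that the consecutive steps of a subdivision qualify. Lists of
    pairs, unlike families over ['I_m], can be spliced and mapped. *)
Definition separated (R : realType) (p q : R * R) : bool :=
  (p.2 <= q.1) || (q.2 <= p.1).

Definition nonoverlapping (R : realType) (s : seq (R * R)) : bool :=
  all (fun p => p.1 <= p.2) s && pairwise (@separated R) s.

Lemma abs_continuousP (R : realType) (g : R -> R) : abs_continuous g <->
  forall e : R, 0 < e -> exists2 d : R, 0 < d & forall s : seq (R * R),
    nonoverlapping s -> \sum_(p <- s) (p.2 - p.1) < d ->
    \sum_(p <- s) `|g p.2 - g p.1| < e.
Proof.
split=> ac e e0; have [d d0 H] := ac e e0; exists d => //.
  move=> s /andP[s1 s2] sd; rewrite (big_nth 0) big_mkord.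
  apply: (H (size s) (fun i => (nth 0 s i).1) (fun i => (nth 0 s i).2)).
  - by move=> i; exact: (all_nthP 0 s1).
  - have sep (i j : 'I_(size s)) : (i < j)%N -> separated (nth 0 s i) (nth 0 s j).
      by move=> ij; apply: (pairwiseP 0 s2) => //; exact: ltn_ord.
    move=> i j _ _ [x /= []]; rewrite !in_itv/= => /andP[ix xi] /andP[jx xj].
    apply/eqP; rewrite eq_le !leEord; apply/andP; split; rewrite leqNgt;
      apply/negP => /sep /orP[]; lra.
  - by rewrite (big_nth 0) big_mkord in sd.
move=> m a b ab tab abd.
(* Degenerate intervals must go: an empty []x, x[] is disjoint from an interval around [x] without
   being [separated] from it. They contribute nothing to either sum. *)
pose s := [seq (a i, b i) | i <- enum 'I_m & a i < b i].
have sumE (F : R -> R -> R) : (forall x, F x x = 0) ->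
    \sum_(i < m) F (a i) (b i) = \sum_(p <- s) F p.1 p.2.
  move=> F0; rewrite /s big_map big_filter -big_enum /= [LHS]big_mkcond [RHS]big_mkcond/=.
  apply: eq_bigr => i _; case: ifPn => //=; rewrite -leNgt => ba.
  by rewrite (_ : a i = b i) ?F0//; apply/le_anti; rewrite ab ba.
rewrite (sumE (fun x y => `|g y - g x|)) => [|x]; last by rewrite subrr normr0.
apply: H; last first.
  by rewrite -(sumE (fun x y => y - x))// => x; rewrite subrr.
apply/andP; split; first by rewrite all_map; apply/allP => i _ /=.
rewrite pairwise_map.
have : pairwise (fun i j => [&& i != j, a i < b i & a j < b j]) [seq i <- enum 'I_m | a i < b i].
  have := enum_uniq 'I_m; rewrite uniq_pairwise.
  elim: (enum 'I_m) => //= i t IH /andP[it /IH{}IH]; case: ifPn => //= abi.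
  rewrite IH andbT; apply/allP => j; rewrite mem_filter abi => /andP[-> jt] /=.
  by rewrite andbT; exact: (allP it).
apply: sub_pairwise => i j /and3P[ij abi abj]; rewrite /separated/=.
apply/negPn; rewrite negb_or -!ltNge; apply/negP => /andP[ji ij'].
move: ij => /negP; apply; apply/eqP; apply: tab => //.
(* The midpoint of the overlap lies in both open intervals. *)
exists ((Num.max (a i) (a j) + Num.min (b i) (b j)) / 2).
have h1 : Num.max (a i) (a j) < Num.min (b i) (b j).
  by rewrite gt_max !lt_min abi abj ji ij'.
have h2 : Num.max (a i) (a j) <= Num.max (a i) (a j) by [].
have h3 : Num.min (b i) (b j) <= Num.min (b i) (b j) by [].
rewrite ge_max in h2; rewrite le_min in h3.
move: h2 h3 => /andP[h2 h2'] /andP[h3 h3'].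
by split; rewrite /= in_itv/=; apply/andP; split; lra.
Qed.

Lemma abs_continuous_uniform (R : realType) (g : R -> R) (e : R) :
  abs_continuous g -> 0 < e -> exists2 d : R, 0 < d &
    forall x y, `|x - y| < d -> `|g x - g y| < e.
Proof.
move=> /abs_continuousP ac e0; have [d d0 H] := ac e e0; exists d => // x y.
wlog xy : x y / x <= y => [hw|].
  have [|/ltW] := leP x y; first exact: hw.
  by move=> yx; rewrite distrC (distrC (g x)); exact: hw.
rewrite distrC ger0_norm ?subr_ge0// => xyd.
have := H [:: (x, y)]; rewrite !big_seq1 distrC; apply => //.
by rewrite /nonoverlapping /= xy.
Qed.

Lemma abs_continuous_continuous (R : realType) (g : R -> R) :
  abs_continuous g -> continuous g.
Proof.
move=> ac x; apply/cvgrPdist_lt => e e0.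
have [d d0 H] := abs_continuous_uniform ac e0.
near=> y; apply: H; near: y.
by exists d.
Unshelve. all: by end_near. Qed.

Lemma abs_continuousD (R : realType) (f g : R -> R) :
  abs_continuous f -> abs_continuous g -> abs_continuous (fun x => f x + g x).
Proof.
move=> /abs_continuousP af /abs_continuousP ag; apply/abs_continuousP => e e0.
have e2 : 0 < e / 2 by rewrite divr_gt0.
have [d1 d10 H1] := af _ e2; have [d2 d20 H2] := ag _ e2.
exists (Num.min d1 d2) => [|s ns]; first by rewrite lt_min d10.
rewrite lt_min => /andP[/(H1 _ ns) h1 /(H2 _ ns) h2].
apply: le_lt_trans (_ : _ <= \sum_(p <- s) `|f p.2 - f p.1| + \sum_(p <- s) `|g p.2 - g p.1|) _.
  rewrite -big_split/=; apply: ler_sum => p _.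
  rewrite (_ : _ - _ = (f p.2 - f p.1) + (g p.2 - g p.1)); last lra.
  exact: ler_normD.
lra.
Qed.

Lemma abs_continuousN (R : realType) (f : R -> R) :
  abs_continuous f -> abs_continuous (fun x => - f x).
Proof.
move=> af e e0; have [d d0 H] := af e e0; exists d => // m a b ab tab abd.
rewrite (eq_bigr (fun i => `|f (b i) - f (a i)|)); first exact: H.
by move=> i _; rewrite -opprD normrN.
Qed.

(** * Total variation of absolutely continuous functions *)

Fixpoint steps (R : realType) (a : R) (l : seq R) : seq (R * R) :=
  if l is x :: l' then (a, x) :: steps x l' else [::].

Lemma variation_steps (R : realType) (a b : R) (f : R -> R) (l : seq R) :
  variation a b f l = \sum_(p <- steps a l) `|f p.2 - f p.1|.
Proof.
elim: l a => [|x l IH] a; first by rewrite /variation /= big_nil big_geq.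
rewrite /= big_cons -IH /variation /= big_nat_recl//=.
Qed.

Lemma steps_length (R : realType) (a : R) (l : seq R) :
  \sum_(p <- steps a l) (p.2 - p.1) = last a l - a.
Proof.
elim: l a => [|x l IH] a; first by rewrite big_nil subrr.
by rewrite /= big_cons IH/=; lra.
Qed.

Lemma steps_bounds (R : realType) (a : R) (l : seq R) : path <%R a l ->
  a <= last a l /\
  forall p, p \in steps a l -> [/\ a <= p.1, p.1 <= p.2 & p.2 <= last a l].
Proof.
elim: l a => [|x l IH] a //= /andP[ax /IH[xl H]].
split; first by rewrite (le_trans (ltW ax)).
move=> p; rewrite inE => /predU1P[->/=|/H[h1 h2 h3]].
  by split => //; exact: ltW.
by split => //; rewrite (le_trans (ltW ax)).
Qed.

Lemma steps_nonoverlapping (R : realType) (a : R) (l : seq R) :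
  path <%R a l -> nonoverlapping (steps a l).
Proof.
move=> pal; apply/andP; split.
  by apply/allP => p /(steps_bounds pal).2[].
elim: l a pal => //= x l IH a /andP[ax xl]; rewrite IH// andbT.
apply/allP => p /(steps_bounds xl).2[xp _ _].
by rewrite /separated/= xp.
Qed.

Lemma nonoverlapping_refine (R : realType) (acc s t : seq (R * R)) (p : R * R) :
  nonoverlapping (acc ++ p :: s) -> nonoverlapping t ->
  (forall q, q \in t -> p.1 <= q.1 /\ q.2 <= p.2) ->
  nonoverlapping (acc ++ t ++ s).
Proof.
move=> /andP[]; rewrite all_cat pairwise_cat /= allrel_consr => /and3P[a1 a2 a3].
move=> /and4P[/andP[b0 b1] b2 b3 b4] /andP[t1 t2] tp.
apply/andP; split; first by rewrite !all_cat a1 a3 t1.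
rewrite !pairwise_cat allrel_catr b1 b2 b4 t2 !andbT /=; apply/andP; split.
  apply/allrelP => q r qa rt; have [pr rp] := tp _ rt.
  by have /orP[h|h] := allP b0 _ qa; apply/orP; [left|right]; lra.
apply/allrelP => r q rt qs; have [pr rp] := tp _ rt.
by have /orP[h|h] := allP b3 _ qs; apply/orP; [left|right]; lra.
Qed.

(** Subdividing an interval preserves total length and nonoverlap, so the bound for sums of
    increments survives the supremum over subdivisions, at the cost of a weak inequality. *)
Lemma abs_continuous_total_variation (R : realType) (g : R -> R) (e : R) :
  abs_continuous g -> 0 < e -> exists2 d : R, 0 < d & forall s : seq (R * R),
    nonoverlapping s -> \sum_(p <- s) (p.2 - p.1) < d ->
    (\sum_(p <- s) total_variation p.1 p.2 g <= e%:E)%E.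
Proof.
move=> /abs_continuousP ac e0; have [d d0 H] := ac e e0; exists d => //.
(* The intervals in [acc] are already subdivided and counted by their increments; those in [s] are
   still counted by their variation. *)
suff key s acc : nonoverlapping (acc ++ s) ->
    \sum_(p <- acc ++ s) (p.2 - p.1) < d ->
    ((\sum_(p <- acc) `|g p.2 - g p.1|)%:E +
     \sum_(p <- s) total_variation p.1 p.2 g <= e%:E)%E.
  by move=> s ns sd; have := key s [::] ns sd; rewrite big_nil add0e.
elim: s acc => [|p s IH] acc nas sd.
  by rewrite big_nil adde0 lee_fin ltW// -[acc]cats0; exact: H.
have pos : p.1 <= p.2.
  by move: nas => /andP[/allP + _]; apply; rewrite mem_cat mem_head orbT.
set S := (\sum_(q <- s) total_variation q.1 q.2 g)%E.
have S0 : (0 <= S)%E.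
  rewrite /S big_seq; apply: sume_ge0 => q qs; apply: total_variation_ge0.
  by move: nas => /andP[/allP + _]; apply; rewrite mem_cat inE qs !orbT.
(* Finiteness is needed before [S] can be moved across the inequality. It comes from the induction
   hypothesis with [p] dropped. *)
have Sfin : S \is a fin_num.
  rewrite ge0_fin_numE//; apply: le_lt_trans (_ : S <= e%:E)%E (ltry _).
  apply: le_trans (IH acc _ _).
  - by rewrite leeDr// lee_fin; apply: sumr_ge0.
  - by have := nonoverlapping_refine (t := [::]) nas; apply.
  - apply: le_lt_trans sd; rewrite !big_cat/= lerD2l big_cons lerDr.
    by rewrite subr_ge0.
rewrite big_cons -/S -(fineK Sfin) addeCA -EFinD -leeBrDr// -EFinB.
apply: ge_ereal_sup => _ [_ [l [pl /eqP ll] <-] <-].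
rewrite lee_fin variation_steps lerBrDr addrC -addrA (addrC (fine S)) addrA -big_cat.
rewrite -lee_fin EFinD fineK//; apply: IH; rewrite -catA.
  apply: nonoverlapping_refine nas _ _; first exact: steps_nonoverlapping.
  by move=> q /(steps_bounds pl).2[h1 _]; rewrite ll.
by move: sd; rewrite !big_cat/= big_cons steps_length ll.
Qed.

(** Cut [[a, b]] into pieces of length at most [d / 2], each of variation at most 1. *)
Lemma abs_continuous_bounded_variation (R : realType) (g : R -> R) (a b : R) :
  abs_continuous g -> a <= b -> total_variation a b g \is a fin_num.
Proof.
move=> ac ab; have [d d0 H] := abs_continuous_total_variation ac ltr01.
have d2 : 0 < d / 2 by rewrite divr_gt0.
have key (n : nat) x : a <= x -> x <= a + n%:R * (d / 2) ->
    (total_variation a x g <= n%:R%:E)%E.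
  elim: n x => [|n IH] x ax.
    by rewrite mul0r addr0 => xa; rewrite (_ : x = a) ?total_variationxx//; lra.
  rewrite -natr1 mulrDl mul1r => xn.
  have [xle|xgt] := leP x (a + n%:R * (d / 2)).
    by rewrite (le_trans (IH _ ax xle))// lee_fin; lra.
  have ay : a <= a + n%:R * (d / 2) by rewrite lerDl mulr_ge0// ltW.
  rewrite (total_variationD _ ay (ltW xgt)) EFinD leeD//; first exact: IH.
  have := H [:: (a + n%:R * (d / 2), x)]; rewrite !big_seq1/=; apply; last lra.
  by rewrite /nonoverlapping/= ltW.
rewrite ge0_fin_numE ?total_variation_ge0//.
apply: le_lt_trans (key (Num.truncn ((b - a) / (d / 2))).+1 b ab _) (ltry _).
rewrite -lerBlDl -ler_pdivrMr//; apply: ltW; exact: truncnS_gt.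
Qed.

(** The projection onto [[a, b]]. Composition with it extends a function from [[a, b]] by constants,
    so that global notions apply to it. *)
Definition clip (R : realType) (a b x : R) : R := Num.min (Num.max x a) b.

Lemma clip_itv (R : realType) (a b x : R) : a <= b -> a <= clip a b x <= b.
Proof. by move=> ab; rewrite /clip le_min ab ge_min lexx le_max lexx !orbT. Qed.

Lemma clip_id (R : realType) (a b x : R) : a <= x <= b -> clip a b x = x.
Proof. by move=> /andP[ax xb]; rewrite /clip max_l// min_l. Qed.

Lemma clip_le (R : realType) (a b x y : R) : x <= y -> clip a b x <= clip a b y.
Proof.
by rewrite /clip /Num.max /Num.min; do 4?[case: ifPn]; rewrite -?leNgt; lra.
Qed.

Lemma clip_dist (R : realType) (a b x y : R) : x <= y ->
  clip a b y - clip a b x <= y - x.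
Proof. by rewrite /clip /Num.max /Num.min; do 4?[case: ifPn]; rewrite -?leNgt; lra. Qed.

Definition clip_pair (R : realType) (a b : R) (p : R * R) : R * R :=
  (clip a b p.1, clip a b p.2).

Lemma nonoverlapping_clip (R : realType) (a b : R) (s : seq (R * R)) :
  nonoverlapping s -> nonoverlapping (map (clip_pair a b) s) /\
  \sum_(p <- map (clip_pair a b) s) (p.2 - p.1) <= \sum_(p <- s) (p.2 - p.1).
Proof.
move=> /andP[/allP s1 s2]; split; last first.
  rewrite big_map big_seq [leRHS]big_seq; apply: ler_sum => p ps.
  by apply: clip_dist; exact: s1.
apply/andP; split.
  by apply/allP => _ /mapP[p ps ->]; apply: clip_le; exact: s1.
rewrite pairwise_map; apply: sub_pairwise s2 => p q /orP[h|h]; apply/orP;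
  [left|right]; exact: clip_le.
Qed.

Lemma abs_continuous_clip (R : realType) (g : R -> R) (a b : R) :
  abs_continuous g -> abs_continuous (g \o clip a b).
Proof.
move=> /abs_continuousP ac; apply/abs_continuousP => e e0.
have [d d0 H] := ac e e0; exists d => // s ns sd.
have [ns' sd'] := nonoverlapping_clip a b ns.
by have := H _ ns' (le_lt_trans sd' sd); rewrite big_map.
Qed.

(** Variation is additive, so increments of the variation function are variations over clipped
    intervals. The second part makes variation minus [g] nondecreasing. *)
Lemma abs_continuous_variation (R : realType) (g : R -> R) (a b : R) : a <= b ->
  abs_continuous g ->
  abs_continuous (fun x => fine (total_variation a (clip a b x) g)) /\
  forall x y, x <= y -> `|g (clip a b y) - g (clip a b x)| <=
    fine (total_variation a (clip a b y) g) - fine (total_variation a (clip a b x) g).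
Proof.
move=> ab ac.
have fin x y : x <= y -> total_variation x y g \is a fin_num.
  exact: abs_continuous_bounded_variation.
have ac_ x : a <= clip a b x by have /andP[] := clip_itv x ab.
have VE x y : x <= y -> fine (total_variation a (clip a b y) g) -
    fine (total_variation a (clip a b x) g) =
    fine (total_variation (clip a b x) (clip a b y) g).
  move=> xy; have cxy := clip_le a b xy.
  by rewrite (total_variationD _ (ac_ x) cxy) fineD ?fin//; lra.
split; last first.
  move=> x y xy; rewrite VE// -lee_fin fineK; last exact/fin/clip_le.
  by apply: total_variation_ge; exact: clip_le.
apply/abs_continuousP => e e0; have e2 : 0 < e / 2 by rewrite divr_gt0.
have [d d0 H] := abs_continuous_total_variation ac e2; exists d => // s ns sd.
have [ns' sd'] := nonoverlapping_clip a b ns.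
have := H _ ns' (le_lt_trans sd' sd); rewrite big_map.
move: ns => /andP[/allP s1 _].
have -> : (\sum_(p <- s) total_variation (clip_pair a b p).1 (clip_pair a b p).2 g =
    (\sum_(p <- s) `|fine (total_variation a (clip a b p.2) g) -
       fine (total_variation a (clip a b p.1) g)|)%:E)%E.
  rewrite -sumEFin big_seq [RHS]big_seq; apply: eq_bigr => p /s1 p12.
  have h : 0 <= fine (total_variation (clip a b p.1) (clip a b p.2) g).
    by apply/fine_ge0/total_variation_ge0/clip_le.
  by rewrite VE// ger0_norm// fineK//; apply/fin/clip_le.
by rewrite lee_fin => /le_lt_trans; apply; lra.
Qed.

(** * Lebesgue-Stieltjes measures and the fundamental theorem of calculus *)

Lemma open_itv_small (R : realType) (I : set R) (d : R) :
  open I -> is_interval I -> (mu_L I < d%:E)%E ->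
  exists a b, a <= b /\ I = `]a, b[%classic.
Proof.
move=> oI iI Id; have [->|/set0P[x Ix]] := eqVneq I set0.
  by exists 0, 0; split => //; rewrite set_itvoo0.
have mI : measurable (I : set (measurableTypeR R)) by exact: open_measurable.
(* The measure bounds the distance between points of [I], so that [I] has a real infimum and
   supremum. *)
have bd y z : I y -> I z -> y <= z -> z - y <= d.
  move=> Iy Iz yz; rewrite -lee_fin; apply: le_trans (ltW Id).
  have -> : (z - y)%:E = mu_L (`[y, z]%classic : set (measurableTypeR R)).
    rewrite lebesgue_measure_itv/= lte_fin EFinB; case: ltP => // zy.
    by rewrite (_ : z = y) ?subee//; lra.
  apply: le_measure; rewrite ?inE//.
  by move=> t /=; rewrite in_itv/=; exact: iI.
have lbI : has_lbound I.
  exists (x - d) => y Iy; have [xy|yx] := leP x y.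
    by have := bd x x Ix Ix (lexx _); lra.
  by have := bd y x Iy Ix (ltW yx); lra.
have ubI : has_ubound I.
  exists (x + d) => y Iy; have [xy|yx] := leP x y.
    by have := bd x y Ix Iy xy; lra.
  by have := bd x x Ix Ix (lexx _); lra.
have IE : I = `]inf I, sup I[%classic.
  rewrite -[LHS](interior_id I).1//.
  rewrite (interval_bounded_interior iI lbI ubI).
  by apply/seteqP; split=> y /=; rewrite in_itv.
exists (inf I), (sup I); split => //.
have : `]inf I, sup I[%classic x by rewrite -IE.
by rewrite /= in_itv/= => /andP[h1 h2]; exact/ltW/(lt_trans h1).
Qed.

Lemma lebesgue_null_open_cover (R : realType) (A : set (measurableTypeR R)) (d : R) :
  measurable A -> mu_L A = 0%E -> 0 < d ->
  exists U : set R, [/\ open U, A `<=` U & (mu_L U < d%:E)%E].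
Proof.
move=> mA A0 d0.
have Afin : (mu_L A < +oo)%E by rewrite A0.
have [U [oU AU UA]] := lebesgue_regularity_outer mA Afin d0.
exists U; split => //.
have mU : measurable (U : set (measurableTypeR R)) by exact: open_measurable.
rewrite (_ : U = A `|` (U `\` A)); last by rewrite setDUK.
apply: le_lt_trans (measureU2 _ mA _) _; first exact: measurableD.
by rewrite [X in (X + _)%E]A0 add0e.
Qed.

Lemma lebesgue_stieltjes_itv (R : realType) (F : cumulative R R) (a b : R) :
  a <= b -> lebesgue_stieltjes_measure F `]a, b]%classic = (F b - F a)%:E.
Proof.
move=> ab; rewrite /lebesgue_stieltjes_measure /measure_extension/=.
by rewrite measurable_mu_extE/=; [rewrite wlength_itv_bnd|exact: is_ocitv].
Qed.

(** A null set lies in an open set of measure less than [d], a countable disjoint union of open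
    intervals. Absolute continuity bounds the increments over finitely many of them, hence every
    partial sum of the Stieltjes measure. *)
Lemma lebesgue_stieltjes_dominates (R : realType) (F : cumulative R R) :
  abs_continuous F -> lebesgue_stieltjes_measure F `<< (@mu_L R).
Proof.
move=> ac; apply/null_content_dominatesP => A mA A0.
apply/eqP; rewrite eq_le measure_ge0 andbT; apply/lee_addgt0Pr => e e0.
rewrite add0e.
have [d d0 H] := ac e e0.
have [U [oU AU Ud]] := lebesgue_null_open_cover mA A0 d0.
have mU : measurable (U : set (measurableTypeR R)) by exact: open_measurable.
apply: (@le_trans _ _ (lebesgue_stieltjes_measure F U)); first by apply: le_measure; rewrite ?inE.
pose I := open_disjoint_itv oU.
have mI j : measurable (I j : set (measurableTypeR R)).
  by apply: open_measurable; exact: open_disjoint_itv_open.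
have UE : U = \bigcup_j I j by exact: open_disjoint_itv_bigcup.
have IU j : (mu_L (I j) < d%:E)%E.
  apply: le_lt_trans Ud; apply: le_measure; rewrite ?inE//.
  by rewrite UE; exact: bigcup_sup.
have /choice[ab abP] : forall j, exists p : R * R, p.1 <= p.2 /\ I j = `]p.1, p.2[%classic.
  move=> j; have [a [b [ab IE]]] := open_itv_small (@open_disjoint_itv_open _ _ oU j)
    (@open_disjoint_itv_is_interval _ _ oU j) (IU j).
  by exists (a, b).
have tI : trivIset setT I by exact: open_disjoint_itv_trivIset.
rewrite UE measure_bigcup//=.
apply: lime_le; first by apply: is_cvg_nneseries => n _ _; exact: measure_ge0.
near=> n; rewrite big_mkord.
apply: (@le_trans _ _ (\sum_(i < n) `|F (ab i).2 - F (ab i).1|)%:E).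
  rewrite -sumEFin big_mkcond/=; apply: lee_sum => i _.
  rewrite in_setT; have [h1 ->] := abP i.
  (* Adding the right endpoint gives an interval whose Stieltjes measure is exactly the
     increment. *)
  apply: le_trans (_ : lebesgue_stieltjes_measure F `](ab i).1, (ab i).2]%classic <= _)%E.
    apply: le_measure; rewrite ?inE; [exact: measurable_itv|exact: measurable_itv|].
    by apply: subset_itvl; rewrite bnd_simp.
  by rewrite lebesgue_stieltjes_itv// lee_fin ler_norm.
rewrite lee_fin ltW//; apply: H => [i||]; first by have [] := abP i.
  move=> i j _ _ [x [xi xj]]; apply/val_inj/tI => //.
  by exists x; rewrite (abP i).2 (abP j).2.
rewrite -lte_fin -sumEFin; apply: le_lt_trans Ud.
rewrite UE measure_bigcup//=.
apply: le_trans (nneseries_lim_ge n _); last by move=> *; exact: measure_ge0.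
rewrite big_mkord [leRHS]big_mkcond/=; apply: lee_sum => i _.
rewrite in_setT; have [h1 ->] := abP i.
rewrite lebesgue_measure_itv/= lte_fin EFinB; case: ltP => // zy.
by rewrite (_ : (ab i).1 = (ab i).2) ?subee//; lra.
Unshelve. all: by end_near. Qed.

(* The density is the Radon-Nikodym derivative of the Lebesgue-Stieltjes measure
   of [H] with respect to the Lebesgue measure. *)
Lemma nondecreasing_AC_density (R : realType) (H : R -> R) (M : R) :
  (forall x y, x <= y -> H x <= H y) -> abs_continuous H ->
  (forall x, `|H x| <= M) ->
  exists f : R -> R, mu_L.-integrable setT (EFin \o f) /\
    forall a b, a <= b -> H b - H a = \int[mu_L]_(x in `]a, b]) f x.
Proof.
move=> nd ac HM.
have rc : right_continuous H.
  by apply: right_continuousW; exact: abs_continuous_continuous.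
pose F : cumulative R R := HB.pack H (isCumulative.Build R _ R H nd rc).
have dom : lebesgue_stieltjes_measure F `<< (@mu_L R).
  exact: lebesgue_stieltjes_dominates.
have fin : fin_num_fun (lebesgue_stieltjes_measure F).
  (* Each []-n, n]] has measure at most [M + M], and these intervals increase to the whole line. *)
  have M2 : (lebesgue_stieltjes_measure F setT <= (M + M)%:E)%E.
    rewrite -(bigcup_itvT false false).
    pose I n : set (measurableTypeR R) := `]- (n%:R), n%:R]%classic.
    have : (lebesgue_stieltjes_measure F \o I) n @[n --> \oo] --> lebesgue_stieltjes_measure F (\bigcup_n I n).
      apply: nondecreasing_cvg_mu; rewrite /I//.
      - by apply: bigcup_measurable => n _; exact: measurable_itv.
      - by move=> *; apply/subsetPset/subset_itv; rewrite leBSide/= ?lerN2 ler_nat.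
    move=> cv; rewrite -(cvg_lim _ cv)//.
    apply: lime_le; first by apply/cvg_ex; eexists; exact: cv.
    near=> n; rewrite /= /I lebesgue_stieltjes_itv; last by rewrite ge0_cp.
    rewrite lee_fin; have := HM n%:R; have := HM (- n%:R).
    by rewrite !ler_norml => /andP[h1 h2] /andP[h3 h4] /=; lra.
  move=> A mA; rewrite ge0_fin_numE ?measure_ge0//.
  apply: le_lt_trans (ltry (M + M)); apply: le_trans M2.
  by apply: le_measure; rewrite ?inE.
pose nu : {finite_measure set (measurableTypeR R) -> \bar R} :=
  HB.pack (lebesgue_stieltjes_measure F)
    (Measure_isFinite.Build _ _ _ (lebesgue_stieltjes_measure F) fin).
have [f [f0 ffin fi fE]] := @radon_nikodym_sigma_finite _ _ R (@mu_L R) nu dom.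
exists (fine \o f); split.
  by apply: eq_integrableT fi => x /=; rewrite fineK.
move=> a b ab; rewrite /Rintegral.
under eq_integral do rewrite /= fineK//.
by rewrite -fE; [rewrite [X in fine X](lebesgue_stieltjes_itv F ab)|exact: measurable_itv].
Unshelve. all: by end_near. Qed.

(* On [a, b] the function [g] is the difference of its variation [V] and of [V - g],
   which are both nondecreasing and absolutely continuous. *)
Lemma abs_continuous_density (R : realType) (g : R -> R) (a b : R) : a <= b ->
  abs_continuous g ->
  exists f : R -> R, mu_L.-integrable setT (EFin \o f) /\
    forall x, a <= x <= b -> g x - g a = \int[mu_L]_(t in `]a, x]) f t.
Proof.
move=> ab ac; pose V x := fine (total_variation a (clip a b x) g).
pose K x := V x + - (g \o clip a b) x.
have [acV VE] := abs_continuous_variation ab ac.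
have acK : abs_continuous K.
  by apply: abs_continuousD acV _; apply/abs_continuousN/abs_continuous_clip.
have ndV x y : x <= y -> V x <= V y.
  by move=> /VE; rewrite -/(V x) -/(V y); have := normr_ge0 (g (clip a b y) - g (clip a b x)); lra.
have ndK x y : x <= y -> K x <= K y.
  move=> /VE; rewrite /K /= -/(V x) -/(V y).
  by have := ler_norm (g (clip a b y) - g (clip a b x)); lra.
(* A nondecreasing function that factors through [clip] is bounded by its values at the endpoints,
   as the density lemma requires. *)
have bnd (W : R -> R) : (forall x y, x <= y -> W x <= W y) ->
    (forall x, W x = W (clip a b x)) -> forall x, `|W x| <= `|W a| + `|W b|.
  move=> ndW Wc x; rewrite Wc; have /andP[ax xb] := clip_itv x ab.
  have := ndW _ _ ax; have := ndW _ _ xb.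
  have := ler_norm (W b); have := ler_norm (- W a); rewrite normrN.
  have := normr_ge0 (W a); have := normr_ge0 (W b).
  by move=> *; rewrite ler_norml; apply/andP; split; lra.
have cc x : clip a b (clip a b x) = clip a b x by rewrite clip_id// clip_itv.
have [f1 [i1 E1]] := nondecreasing_AC_density ndV acV (bnd V ndV (fun x => ltac:(by rewrite /V cc))).
have [f2 [i2 E2]] := nondecreasing_AC_density ndK acK (bnd K ndK (fun x => ltac:(by rewrite /K /V /= cc))).
exists (fun x => f1 x - f2 x); split.
  exact: (integrableB measurableT i1 i2).
move=> x /andP[ax xb].
have iS (f : R -> R) : mu_L.-integrable setT (EFin \o f) ->
    mu_L.-integrable `]a, x] (EFin \o f).
  by apply: integrableS => //; exact: measurable_itv.
rewrite RintegralB; [|exact: measurable_itv|exact: iS|exact: iS].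
rewrite -E1// -E2// /K /= !clip_id ?lexx ?ax//; lra.
Qed.

(** Lebesgue differentiation of the integral of the density. The representation of [g] holds on
    [[a, b]], which is a neighbourhood of each interior point. *)
Lemma abs_continuous_is_derive (R : realType) (g : R -> R) (a b : R) : a <= b ->
  abs_continuous g ->
  exists f : R -> R, [/\ mu_L.-integrable setT (EFin \o f),
    forall x, a <= x <= b -> g x - g a = \int[mu_L]_(t in `]a, x]) f t &
    {ae mu_L, forall x, a < x < b -> is_derive x 1 g (f x)}].
Proof.
move=> ab ac; have [f [fi fE]] := abs_continuous_density ab ac.
exists f; split => //.
have Fi y : mu_L.-integrable [set` Interval (BRight a) (BRight y)] (EFin \o f).
  by apply: integrableS fi => //; exact: measurable_itv.
have locf : locally_integrable setT f.
  split; [by apply/measurable_EFinP; exact: measurable_int fi|exact: openT|].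
  move=> K _ cK.
  have mK : measurable (K : set (measurableTypeR R)) by exact: compact_measurable.
  have : mu_L.-integrable K (EFin \o f) by apply: integrableS fi.
  by case/integrableP.
have := FTC1 Fi locf; apply: filterS; first exact: (ae_filter_ringOfSetsType mu_L).
move=> x /= Hx /andP[ax xb].
have /Hx[dF <-] : (BRight a < BRight x)%O by rewrite bnd_simp.
have dF' : is_derive x 1 (fun y => \int[mu_L]_(t in `]a, y]) f t + g a)
   ((fun y => \int[mu_L]_(t in `]a, y]) f t)^`()%classic x).
  rewrite derive1E -[X in is_derive _ _ _ X]addr0.
  apply: is_deriveD; exact/derivableP.
apply: (@near_eq_is_derive R R R _ _ _ _ _ _ dF').
near=> y; rewrite -fE ?subrK//.
have : y \in `]a, b[ by near: y; apply: near_in_itvoo; rewrite in_itv/= ax.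
by rewrite in_itv/= => /andP[/ltW -> /ltW ->].
Unshelve. all: by end_near. Qed.

Lemma abs_continuous_derivable (R : realType) (g : R -> R) :
  abs_continuous g -> {ae mu_L, forall x : R, derivable g x 1}.
Proof.
move=> ac.
have H (N : nat) : {ae mu_L, forall x : R, - N%:R < x < N%:R -> derivable g x 1}.
  have N0 : - (N%:R : R) <= N%:R by rewrite ge0_cp.
  have [f [_ _ df]] := abs_continuous_is_derive N0 ac.
  by apply: (ae_lebesgue_mono df) => x /= h /h[].
apply: (ae_lebesgue_mono (ae_foralln H)) => x Hx.
apply: (Hx (Num.truncn `|x|).+1); rewrite -ltr_norml.
exact: truncnS_gt.
Qed.

(** The density and [h] both agree with the derivative almost everywhere on []a, b[]. *)
Lemma abs_continuous_FTC (R : realType) (g h : R -> R) (a b : R) : a <= b ->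
  abs_continuous g -> mu_L.-integrable setT (EFin \o h) ->
  ae_eq mu_L setT g^`()%classic h ->
  g b - g a = \int[mu_L]_(t in `]a, b]) h t.
Proof.
move=> ab ac hi gh; have [f [fi fE df]] := abs_continuous_is_derive ab ac.
rewrite fE ?ab ?lexx//.
have iS (k : R -> R) : mu_L.-integrable setT (EFin \o k) ->
    mu_L.-integrable `]a, b[ (EFin \o k).
  by apply: integrableS => //; exact: measurable_itv.
rewrite -!Rintegral_itv_bndo_bndc; [|exact: iS|exact: iS].
rewrite Rintegral_mkcond [RHS]Rintegral_mkcond; apply: ae_eq_Rintegral.
rewrite /ae_eq.
apply: (ae_lebesgue_mono2 df gh) => x dfx ghx _; rewrite !patchE; case: ifPn => //.
rewrite inE/= in_itv/= => /dfx[_ <-]; rewrite -ghx//.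
by rewrite derive1E.
Qed.

(** * Integration by parts against test functions *)

Lemma test_fun_lipschitz (R : realType) (phi : R -> R) : test_fun phi ->
  exists2 L, 0 < L & forall x y, `|phi x - phi y| <= L * `|x - y|.
Proof.
move=> tp; have [L L0 HL] := test_fun_bounded (test_fun_derive1n 1 tp).
have /test_funP[sp _] := tp.
exists L => // x y; wlog xy : x y / x <= y => [hw|].
  have [|/ltW] := leP x y; first exact: hw.
  by move=> yx; rewrite distrC (distrC x); exact: hw.
have [||c _ E] := @MVT_segment R phi phi^`()%classic x y xy.
- by move=> z _; rewrite derive1E; apply/derivableP/smooth_derivable.
- exact/continuous_subspaceT/smooth_continuous.
by rewrite distrC E normrM (distrC x) ler_wpM2r//; exact: HL.
Qed.

Lemma abs_continuous_mul_test (R : realType) (g phi : R -> R) (M : R) :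
  abs_continuous g -> (forall x, `|g x| <= M) -> test_fun phi ->
  abs_continuous (fun x => g x * phi x).
Proof.
move=> /abs_continuousP ac gM tp; have [L L0 HL] := test_fun_lipschitz tp.
have [B B0 HB] := test_fun_bounded tp.
have M0 : 0 <= M by exact: le_trans (gM 0).
have ML : 0 < M * L + 1 by rewrite ltr_wpDl// mulr_ge0// ltW.
apply/abs_continuousP => e e0.
(* An increment of the product is [phi] times an increment of [g] plus [g] times an increment of
   [phi]. Each part gets [e / 2]; the 1 in [M * L + 1] guards against a zero divisor. *)
have [d d0 H] := ac (e / 2 / B) ltac:(by rewrite !divr_gt0).
exists (Num.min d (e / 2 / (M * L + 1))) => [|s ns].
  by rewrite lt_min d0 !divr_gt0.
rewrite lt_min => /andP[/(H _ ns) h1 h2].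
apply: (@le_lt_trans _ _ (B * \sum_(p <- s) `|g p.2 - g p.1| + M * L * \sum_(p <- s) (p.2 - p.1))).
  rewrite !mulr_sumr -big_split/= big_seq [leRHS]big_seq; apply: ler_sum => p ps.
  have p12 : p.1 <= p.2 by move: ns => /andP[/allP + _]; exact.
  have -> : g p.2 * phi p.2 - g p.1 * phi p.1 =
    phi p.2 * (g p.2 - g p.1) + g p.1 * (phi p.2 - phi p.1) by lra.
  apply: le_trans (ler_normD _ _) _; rewrite !normrM lerD//; first by rewrite ler_wpM2r.
  rewrite -mulrA ler_pM//.
  by apply: le_trans (HL _ _) _; rewrite ger0_norm ?subr_ge0.
have s0 : 0 <= \sum_(p <- s) (p.2 - p.1).
  rewrite big_seq; apply: sumr_ge0 => p ps; rewrite subr_ge0.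
  by move: ns => /andP[/allP + _]; exact.
move: h1 h2; rewrite !ltr_pdivlMr// => h1 h2.
have : M * L * \sum_(p <- s) (p.2 - p.1) <= (M * L + 1) * \sum_(p <- s) (p.2 - p.1).
  by rewrite ler_wpM2r// lerDl.
lra.
Qed.

Lemma test_fun_integrableM (R : realType) (f phi : R -> R) : test_fun phi ->
  mu_L.-integrable setT (EFin \o f) ->
  mu_L.-integrable setT (EFin \o (fun x => f x * phi x)).
Proof.
move=> tp fi; have [M M0 HM] := test_fun_bounded tp.
have mf : measurable_fun setT f by apply/measurable_EFinP; exact: measurable_int fi.
have mp : measurable_fun setT phi by case: (test_fun_sqint tp).
apply: le_integrable (integrableZl measurableT M fi) => //.
  by apply/measurable_EFinP; exact: measurable_funM.
move=> x _ /=; rewrite lee_fin !normrM mulrC ler_wpM2r//.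
by rewrite (le_trans (HM x))// ler_norm.
Qed.

(** The fundamental theorem for the product [g phi] on an interval at whose ends [phi] vanishes. *)
Lemma abs_continuous_parts (R : realType) (g f phi : R -> R) (M : R) :
  abs_continuous g -> (forall x, `|g x| <= M) ->
  mu_L.-integrable setT (EFin \o f) -> ae_eq mu_L setT g^`()%classic f ->
  test_fun phi ->
  \int[mu_L]_x (g x * phi^`()%classic x) = - \int[mu_L]_x (f x * phi x).
Proof.
move=> ac gM fi gf tp; have tp' := test_fun_derive1n 1 tp.
have cg := abs_continuous_continuous ac.
have mg : measurable_fun setT g by exact: continuous_measurable_fun.
have i1 : mu_L.-integrable setT (EFin \o (fun x => g x * phi^`()%classic x)).
  have pi := test_fun_integrable tp'.
  apply: le_integrable (integrableZl measurableT M pi) => //.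
    apply/measurable_EFinP; apply: measurable_funM => //.
    by apply/measurable_EFinP; exact: measurable_int pi.
  move=> x _ /=; rewrite lee_fin !normrM ler_wpM2r//.
  by rewrite (le_trans (gM x))// ler_norm.
have i2 := test_fun_integrableM tp fi.
have i3 := integrableD measurableT i1 i2.
have /test_funP[sp [N HN]] := tp.
pose h x := g x * phi^`()%classic x + f x * phi x.
have dP : ae_eq mu_L setT (fun x => g x * phi x)^`()%classic h.
  rewrite /ae_eq.
  apply: (ae_lebesgue_mono2 (abs_continuous_derivable ac) gf) => x dg gfx _.
  rewrite /h -gfx// !derive1E.
  have := deriveM dg (@smooth_derivable _ phi x sp) => ->.
  by congr (_ + _); exact: mulrC.
(* [N] may be negative; [A] is nonnegative and larger than [N]. *)
pose A := `|N| + 1.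
have A0 : - A <= A by rewrite ge0_cp// addr_ge0.
have := abs_continuous_FTC A0 (abs_continuous_mul_test ac gM tp) i3 dP.
have NA : N < A by rewrite (le_lt_trans (ler_norm _))// ltrDl.
have AA : `|A| = A by rewrite ger0_norm// addr_ge0.
rewrite !HN ?normrN ?AA// !mulr0 subrr Rintegral_mkcond => /esym.
suff -> : \int[mu_L]_x (h \_ `]- A, A]) x = \int[mu_L]_x h x.
  by rewrite /h RintegralD//; lra.
apply: eq_Rintegral => x _; rewrite patchE; case: ifPn => //.
rewrite notin_setE/= in_itv/= => /negP Ax.
have Nx : N < `|x|.
  rewrite ltNge; apply/negP => xN; apply/(negP Ax).
  by move: (le_lt_trans xN NA); rewrite ltr_norml => /andP[-> /ltW].
have D0 : phi^`()%classic x = 0 := derive1n_eq0 1 HN Nx.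
by rewrite /h HN// D0 !mulr0 addr0.
Qed.

(** By uniform continuity [g] varies by less than 1 on [[x, x + d / 2]], so a large value at [x]
    contributes at least [(|g x| - 1) * (d / 2)] to the L1 norm. *)
Lemma abs_continuous_integrable_bounded (R : realType) (g : R -> R) :
  abs_continuous g -> mu_L.-integrable setT (EFin \o g) ->
  exists M, forall x, `|g x| <= M.
Proof.
move=> ac gi; have [d d0 H] := abs_continuous_uniform ac ltr01.
have d2 : 0 < d / 2 by rewrite divr_gt0.
have /integrableP[mg gfin] := gi.
set J := (\int[mu_L]_x `|(EFin \o g) x|)%E in gfin.
have J0 : (0 <= J)%E by exact: integral_ge0.
have Jfin : J \is a fin_num by rewrite ge0_fin_numE.
exists (1 + fine J / (d / 2)) => x.
have [gx|gx] := leP `|g x| 1.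
  by rewrite (le_trans gx)// lerDl divr_ge0// ?fine_ge0// ltW.
rewrite -lerBlDl ler_pdivlMr// -lee_fin fineK//.
pose I : set (measurableTypeR R) := `[x, x + d / 2]%classic.
have mI : measurable I by exact: measurable_itv.
apply: (@le_trans _ _ (\int[mu_L]_(t in I) `|(EFin \o g) t|)%E); last first.
  apply: ge0_subset_integral => //.
  exact: measurableT_comp.
have -> : ((`|g x| - 1) * (d / 2))%:E = (\int[mu_L]_(t in I) (`|g x| - 1)%:E)%E.
  have muI : mu_L I = (d / 2)%:E.
    by rewrite /I lebesgue_measure_itv/= lte_fin ltrDl d2 -EFinB; congr EFin; lra.
  transitivity ((`|g x| - 1)%:E * mu_L I)%E; first by rewrite muI EFinM.
  by rewrite integral_cst.
apply: ge0_le_integral => //.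
- by move=> t _; rewrite lee_fin subr_ge0 ltW.
- by apply: measurable_funTS; exact: measurableT_comp.
- move=> t; rewrite /I /= in_itv/= => /andP[xt tx]; rewrite lee_fin.
  have : `|g x - g t| < 1 by apply: H; rewrite distrC ger0_norm; lra.
  by have := ler_normD (g x - g t) (g t); rewrite subrK; lra.
Qed.

Lemma BV_bounded (R : realType) (F : R -> R) : BV F ->
  exists M, forall x, `|F x| <= M.
Proof.
move=> [_ [M HM]]; exists (`|F 0| + M) => x.
have key a b : a <= b -> `|F b - F a| <= M.
  by move=> ab; rewrite -lee_fin; apply: le_trans (HM a b ab); exact: total_variation_ge.
have : `|F x - F 0| <= M.
  have [/key//|/ltW/key] := leP 0 x; by rewrite distrC.
by have := ler_normD (F x - F 0) (F 0); rewrite subrK; lra.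
Qed.

(** Below order [n] the derivative is its own representative. At order [n] it may be neither Borel
    nor bounded, and the function of bounded variation replaces it. *)
Lemma regular_repr (R : realType) (n : nat) (G : R -> R) (k : nat) :
  regular n G -> (k <= n)%N -> exists f M,
  [/\ mu_L.-integrable setT (EFin \o f), forall x, `|f x| <= M &
      ae_eq mu_L setT (derive1n k G) f].
Proof.
move=> [_ ac intG [F BF GF]]; rewrite leq_eqVlt => /predU1P[->|kn].
  by have [M HM] := BV_bounded BF; exists F, M; split => //; case: BF.
have [M HM] := abs_continuous_integrable_bounded (ac _ kn) (intG _ kn).
by exists (derive1n k G), M; split => //; [exact: intG|exact: ae_eq_refl].
Qed.

(** One integration by parts per derivative. The induction varies [phi], since its hypothesis is
    applied to the derivative of [phi]. *)
Lemma regular_parts (R : realType) (n : nat) (G : R -> R) (k : nat) (phi : R -> R) :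
  regular n G -> (k <= n)%N -> test_fun phi ->
  \int[mu_L]_t (G t * derive1n k phi t) =
  (-1) ^+ k * \int[mu_L]_t (derive1n k G t * phi t).
Proof.
move=> rG; elim: k phi => [|k IH] phi kn tp; first by rewrite expr0 mul1r.
rewrite derive1Sn (IH _ (ltnW kn) (test_fun_derive1n 1 tp)) exprS mulN1r mulNr -mulrN.
congr (_ * _); have [_ ac intG _] := rG.
have [M HM] := abs_continuous_integrable_bounded (ac _ kn) (intG _ kn).
have [f [_ [fi _ Gf]]] := regular_repr rG kn.
rewrite (abs_continuous_parts (ac _ kn) HM fi Gf tp); congr (- _).
by apply: ae_eq_Rintegral; rewrite /ae_eq; apply: (ae_lebesgue_mono Gf) => x /(_ I) ->.
Qed.

(** * Weak derivatives *)

Lemma ae_eq_mulr (R : realType) (f g h : R -> R) : ae_eq mu_L setT f g ->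
  ae_eq mu_L setT (fun x => f x * h x) (fun x => g x * h x).
Proof.
by move=> fg; rewrite /ae_eq; apply: (ae_lebesgue_mono fg) => x /(_ I) ->.
Qed.

Lemma L2_ae (R : realType) (u v : R -> R) : ae_eq mu_L setT u v -> L2 u -> L2 v.
Proof.
move=> uv [w w2 uw]; exists w => //; rewrite /ae_eq.
by apply: (ae_lebesgue_mono2 uv uw) => x h1 h2 xT; rewrite -h1// h2.
Qed.

Lemma sqint_L2 (R : realType) (u : R -> R) : sqint u -> L2 u.
Proof. by move=> su; apply/L2P; exists u => //; exact: ae_eq_refl. Qed.

Lemma L2_lin (R : realType) (a : R) (u v : R -> R) : L2 u -> L2 v ->
  L2 (fun x => a * u x + v x).
Proof.
move=> /L2P[u' su uu] /L2P[v' sv vv]; apply/L2P.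
exists (fun x => a * u' x + v' x); first exact: (sqintD (sqintZ a su) sv).
by rewrite /ae_eq; apply: (ae_lebesgue_mono2 uu vv) => x /(_ I) -> /(_ I) ->.
Qed.

(** Linearity of the integral requires integrable, hence Borel, functions, so all three are first
    replaced by Borel representatives. *)
Lemma Rintegral_L2_lin (R : realType) (a : R) (u v w : R -> R) : L2 u -> L2 v -> L2 w ->
  \int[mu_L]_x ((a * u x + v x) * w x) =
  a * \int[mu_L]_x (u x * w x) + \int[mu_L]_x (v x * w x).
Proof.
move=> /L2P[u' su uu] /L2P[v' sv vv] /L2P[w' sw ww].
have -> : \int[mu_L]_x (u x * w x) = \int[mu_L]_x (u' x * w' x).
  apply: ae_eq_Rintegral; rewrite /ae_eq.
  by apply: (ae_lebesgue_mono2 uu ww) => x /(_ I) -> /(_ I) ->.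
have -> : \int[mu_L]_x (v x * w x) = \int[mu_L]_x (v' x * w' x).
  apply: ae_eq_Rintegral; rewrite /ae_eq.
  by apply: (ae_lebesgue_mono2 vv ww) => x /(_ I) -> /(_ I) ->.
have -> : \int[mu_L]_x ((a * u x + v x) * w x) = \int[mu_L]_x (a * (u' x * w' x) + v' x * w' x).
  apply: ae_eq_Rintegral; rewrite /ae_eq.
  apply: (ae_lebesgue_mono2 (ae_lebesgue_mono2 uu vv (fun x => @conj _ _)) ww).
  by move=> x [h1 h2] h3 xT; rewrite h1// h2// h3// mulrDl mulrA.
rewrite RintegralD//; last 2 first.
- exact: (integrableZl measurableT a (sqint_mul su sw)).
- exact: sqint_mul.
by rewrite RintegralZl// sqint_mul.
Qed.

Lemma test_fun_L2 (R : realType) (phi : R -> R) : test_fun phi -> L2 phi.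
Proof. by move=> /test_fun_sqint/sqint_L2. Qed.

Lemma weak_derive_unique (R : realType) (k : nat) (u w w' : R -> R) :
  is_weak_derive k u w -> is_weak_derive k u w' -> ae_eq mu_L setT w w'.
Proof.
move=> [_ Lw H] [_ Lw' H'].
have /L2P[z sz wz] := L2_lin (-1) Lw Lw'.
have z0 : ae_eq mu_L setT z (cst 0).
  apply: fundamental_lemma => // phi tp.
  have -> : \int[mu_L]_x (z x * phi x) = \int[mu_L]_x ((-1 * w x + w' x) * phi x).
    by apply/esym/ae_eq_Rintegral; exact: (ae_eq_mulr (f := fun x => -1 * w x + w' x)).
  rewrite Rintegral_L2_lin//; last exact: test_fun_L2.
  have := H _ tp; rewrite H'// => /(congr1 ( *%R ((-1) ^+ k))).
  by rewrite !mulrA -expr2 sqrr_sign !mul1r => ->; lra.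
rewrite /ae_eq; apply: (ae_lebesgue_mono2 wz z0) => x /(_ I) h1 /(_ I) h2 _.
by move: h1; rewrite h2 /=; lra.
Qed.

Lemma is_weak_derive_ae (R : realType) (k : nat) (u u' w w' : R -> R) :
  ae_eq mu_L setT u u' -> ae_eq mu_L setT w w' ->
  is_weak_derive k u w -> is_weak_derive k u' w'.
Proof.
move=> uu ww [Lu Lw H]; split; [exact: L2_ae Lu|exact: L2_ae Lw|move=> phi tp].
have := H _ tp.
by rewrite (ae_eq_Rintegral (ae_eq_mulr _ uu)) (ae_eq_Rintegral (ae_eq_mulr _ ww)).
Qed.

Lemma is_weak_derive_lin (R : realType) (k : nat) (a : R) (u u' w w' : R -> R) :
  is_weak_derive k u w -> is_weak_derive k u' w' ->
  is_weak_derive k (fun x => a * u x + u' x) (fun x => a * w x + w' x).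
Proof.
move=> [Lu Lw H] [Lu' Lw' H']; split; [exact: L2_lin|exact: L2_lin|move=> phi tp].
rewrite Rintegral_L2_lin//; last exact/test_fun_L2/test_fun_derive1n.
rewrite Rintegral_L2_lin//; last exact: test_fun_L2.
by rewrite H// H'//; lra.
Qed.

Lemma is_weak_derive0 (R : realType) (u : R -> R) : L2 u -> is_weak_derive 0 u u.
Proof. by move=> Lu; split => // phi _; rewrite expr0 mul1r. Qed.

Lemma sobolevP (R : realType) (n k : nat) (u : R -> R) : sobolev n u -> (k <= n)%N ->
  is_weak_derive k u (weak_derive k u).
Proof. by move=> su /su; exact: xgetPex. Qed.

Lemma weak_deriveE (R : realType) (k : nat) (u w : R -> R) :
  is_weak_derive k u w -> ae_eq mu_L setT (weak_derive k u) w.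
Proof.
move=> H; apply: (weak_derive_unique _ H).
exact: (@xgetPex _ (cst 0) [set w | is_weak_derive k u w] (ex_intro _ w H)).
Qed.

Lemma sobolev_ae (R : realType) (n : nat) (u v : R -> R) :
  ae_eq mu_L setT u v -> sobolev n u -> sobolev n v.
Proof.
move=> uv su k /su[w uw]; exists w; apply: is_weak_derive_ae uv _ uw.
exact: ae_eq_refl.
Qed.

(** Equality holds everywhere, because [xget] chooses from the same set of candidates on both
    sides. *)
Lemma weak_derive_ae (R : realType) (k : nat) (u v : R -> R) :
  ae_eq mu_L setT u v -> weak_derive k u = weak_derive k v.
Proof.
move=> uv; rewrite /weak_derive; congr (xget _ _).
apply/seteqP; split=> w; apply: is_weak_derive_ae => //; try exact: ae_eq_refl.
exact: ae_eq_sym.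
Qed.

(** Frees the inner product from the choice made in [weak_derive], so that each computation may use
    convenient weak derivatives. *)
Lemma sobolev_innerE (R : realType) (n : nat) (u v : R -> R) (U V : nat -> R -> R) :
  (forall k, (k <= n)%N -> is_weak_derive k u (U k)) ->
  (forall k, (k <= n)%N -> is_weak_derive k v (V k)) ->
  sobolev_inner n u v = \sum_(k < n.+1) \int[mu_L]_t (U k t * V k t).
Proof.
move=> HU HV; apply: eq_bigr => k _; apply: ae_eq_Rintegral; rewrite /ae_eq.
have kn : (k <= n)%N by rewrite -ltnS.
apply: (ae_lebesgue_mono2 (weak_deriveE (HU _ kn)) (weak_deriveE (HV _ kn))).
by move=> x /(_ I) -> /(_ I) ->.
Qed.

(** * Reflected functions and their weak derivatives *)

Lemma derive1n_reflect (R : realType) (phi : R -> R) (x : R) (k : nat) : smooth phi ->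
  derive1n k (fun t => phi (x - t)) = (fun t => (-1) ^+ k * derive1n k phi (x - t)).
Proof.
move=> sp; elim: k => [|k IH]; first by apply/funext => t; rewrite expr0 mul1r.
rewrite derive1nS IH; apply/funext => t; rewrite derive1E.
have d1 : is_derive (x - t) 1 (derive1n k phi) (derive1n k.+1 phi (x - t)).
  by rewrite derive1nS derive1E; exact/derivableP.
have d2 : is_derive t 1 (fun t : R => x - t) (0 - 1) by exact: is_deriveB.
have d3 := is_deriveZ ((-1) ^+ k) (@is_derive1_comp R (derive1n k phi) (fun t => x - t) t _ _ d1 d2).
have [_ /= E] := d3; move: E; rewrite /GRing.scale/= => E.
transitivity ((-1) ^+ k * (derive1n k.+1 phi (x - t) * (0 - 1))); first exact: E.
by rewrite exprS derive1nS; lra.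
Qed.

Lemma test_fun_reflect (R : realType) (phi : R -> R) (x : R) : test_fun phi ->
  test_fun (fun t => phi (x - t)).
Proof.
move=> /test_funP[sp [N HN]]; apply/test_funP; split.
  rewrite (_ : (fun t => _) = fun t => phi (-1 * t + x)); first exact: smooth_affine.
  by apply/funext => t; congr phi; lra.
exists (`|x| + N) => t Nt; apply: HN.
by have := ler_normB x (x - t); rewrite opprB addrC subrK; lra.
Qed.

Lemma Rintegral_reflect_ae (R : realType) (x : R) (f g : R -> R) :
  measurable_fun setT g -> ae_eq mu_L setT f g ->
  \int[mu_L]_t f (x - t) = \int[mu_L]_t f t.
Proof.
move=> mg fg; rewrite (ae_eq_Rintegral fg) -(Rintegral_reflect x mg).
apply: ae_eq_Rintegral; rewrite /ae_eq.
exact: (ae_reflect (P := fun t => setT t -> f t = g t) x fg).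
Qed.

Lemma Rintegral_reflect_mul (R : realType) (x : R) (u v : R -> R) : L2 u -> L2 v ->
  \int[mu_L]_t (u (x - t) * v t) = \int[mu_L]_t (u t * v (x - t)).
Proof.
move=> /L2P[u' [mu' _] uu] /L2P[v' [mv _] vv].
have vv' := ae_reflect (P := fun t => setT t -> v t = v' t) x vv.
rewrite -(@Rintegral_reflect_ae _ x (fun t => u t * v (x - t)) (fun t => u' t * v' (x - t))).
- by apply: eq_Rintegral => t _; rewrite subKr.
- by apply: measurable_funM => //; exact: (measurableT_comp mv (measurable_reflect x)).
- by rewrite /ae_eq; apply: (ae_lebesgue_mono2 uu vv') => t /(_ I) -> /(_ I) ->.
Qed.

Lemma L2_reflect (R : realType) (x : R) (u : R -> R) : L2 u -> L2 (fun t => u (x - t)).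
Proof.
move=> /L2P[u' su uu]; apply/L2P; exists (fun t => u' (x - t)).
  exact: sqint_reflect.
exact: (ae_reflect (P := fun t => setT t -> u t = u' t) x uu).
Qed.

(** The substitution of [x - t] for [t] moves the reflection to the test function, whose derivative
    of order [k] acquires the sign. *)
Lemma is_weak_derive_reflect (R : realType) (k : nat) (x : R) (u w : R -> R) :
  is_weak_derive k u w ->
  is_weak_derive k (reflect_at u x) (fun t => (-1) ^+ k * w (x - t)).
Proof.
move=> [Lu Lw H]; split; first exact: L2_reflect.
  have := L2_lin ((-1) ^+ k) (L2_reflect x Lw) (sqint_L2 (@sqint0 R)).
  by rewrite (_ : (fun t => _ + _) = fun t => (-1) ^+ k * w (x - t))//; apply/funext => t /=; rewrite addr0.
move=> phi tp; have tr := test_fun_reflect x tp; have /test_funP[sp _] := tp.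
rewrite Rintegral_reflect_mul//; last exact/test_fun_L2/test_fun_derive1n.
have := H _ tr; rewrite derive1n_reflect// => E.
have Lphi := L2_reflect x (test_fun_L2 (test_fun_derive1n k tp)).
have Lp := test_fun_L2 tp.
(* Linearity with second summand 0 gives homogeneity; [E0] then clears the terms left over. *)
have L0 := sqint_L2 (@sqint0 R).
have E1 := Rintegral_L2_lin ((-1) ^+ k) Lphi L0 Lu.
have E2 := Rintegral_L2_lin ((-1) ^+ k) (L2_reflect x Lw) L0 Lp.
have E0 z : \int[mu_L]_t (cst (0 : R) t * z t) = 0 :> R.
  rewrite -[RHS](mul0r (fine (mu_L (setT : set (measurableTypeR R))))) -Rintegral_cst//.
  by apply: eq_Rintegral => t _ /=; rewrite mul0r.
rewrite !E0 !addr0 in E1 E2.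
transitivity (\int[mu_L]_t (derive1n k phi (x - t) * u t)).
  by apply: eq_Rintegral => t _; rewrite mulrC.
transitivity ((-1) ^+ k * ((-1) ^+ k * \int[mu_L]_t (derive1n k phi (x - t) * u t))).
  by rewrite mulrA -expr2 sqrr_sign mul1r.
congr (_ * _); rewrite -E1.
transitivity ((-1) ^+ k * \int[mu_L]_t (w t * phi (x - t))).
  by rewrite -E; apply: eq_Rintegral => t _; rewrite mulrC addr0.
rewrite -Rintegral_reflect_mul// -E2.
by apply: eq_Rintegral => t _; rewrite addr0.
Qed.

Lemma regular_weak_derive (R : realType) (n : nat) (G : R -> R) (k : nat) :
  regular n G -> (k <= n)%N -> is_weak_derive k G (derive1n k G).
Proof.
move=> rG kn.
have L2G j : (j <= n)%N -> L2 (derive1n j G).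
  move=> /(regular_repr rG)[f [M [fi fM Gf]]].
  by apply: L2_ae (ae_eq_sym Gf) (sqint_L2 (bounded_sqint fM fi)).
split; [exact: (L2G 0%N (leq0n n))|exact: L2G|move=> phi].
exact: regular_parts rG kn.
Qed.

(** * Convolutions vanish at infinity *)

Lemma cvg_approx (R : realType) (T : Type) (F : set_system T) (h : T -> R) (l : R) :
  Filter F ->
  (forall e, 0 < e -> exists h' l', [/\ h' x @[x --> F] --> (l' : R), `|l - l'| <= e &
     forall x, `|h x - h' x| <= e]) ->
  h x @[x --> F] --> l.
Proof.
move=> FF H; apply/cvgrPdist_lt => e e0.
have e3 : 0 < e / 4 by rewrite divr_gt0.
have [h' [l' [hl ll hh]]] := H _ e3.
move/cvgrPdist_lt : hl => /(_ _ e3); apply: filterS => x hx.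
have := hh x; rewrite distrC => hhx.
have := ler_normD (l - l') (l' - h x); have := ler_normD (l' - h' x) (h' x - h x).
by rewrite !addrA !subrK; lra.
Qed.

Lemma C0_approx (R : realType) (h : R -> R) :
  (forall e, 0 < e -> exists2 h', C0 h' & forall x, `|h x - h' x| <= e) -> C0 h.
Proof.
move=> H; split.
- move=> x; apply: cvg_approx => e /H[h' [ch _ _] hh].
  by exists h', (h' x); split => //; exact: ch.
- apply: cvg_approx => e e0; have [h' [_ h0 _] hh] := H e e0.
  by exists h', 0; split => //; rewrite subrr normr0 ltW.
- apply: cvg_approx => e e0; have [h' [_ _ h0] hh] := H e e0.
  by exists h', 0; split => //; rewrite subrr normr0 ltW.
Qed.

Lemma integrableM_bounded (R : realType) (p q : R -> R) (B : R) :
  mu_L.-integrable setT (EFin \o p) -> measurable_fun setT q ->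
  (forall x, `|q x| <= B) -> mu_L.-integrable setT (EFin \o (fun x => p x * q x)).
Proof.
move=> ip mq qB.
have mp : measurable_fun setT p by apply/measurable_EFinP; exact: measurable_int ip.
apply: le_integrable (integrableZl measurableT B ip) => //.
  by apply/measurable_EFinP; exact: measurable_funM.
move=> x _ /=; rewrite lee_fin !normrM mulrC ler_wpM2r//.
by rewrite (le_trans (qB x))// ler_norm.
Qed.

Lemma normr_Rintegral_mul_le (R : realType) (p q : R -> R) (B : R) :
  mu_L.-integrable setT (EFin \o p) -> measurable_fun setT q ->
  (forall x, `|q x| <= B) ->
  `|\int[mu_L]_x (p x * q x)| <= B * \int[mu_L]_x `|p x|.
Proof.
move=> ip mq qB.
have ipq := integrableM_bounded ip mq qB.
apply: le_trans (le_normr_Rintegral _ ipq) _ => //.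
have ia : mu_L.-integrable setT (EFin \o (fun x => `|p x|)) by exact: integrable_norm.
rewrite -RintegralZl//; apply: le_Rintegral => //.
- exact: integrable_norm.
- exact: (integrableZl measurableT B ia).
- by move=> x _; rewrite normrM mulrC ler_wpM2r.
Qed.

Lemma measurable_restrictR (R : realType) (f : R -> R) (A : set (measurableTypeR R)) :
  measurable A -> measurable_fun setT f -> measurable_fun setT (f \_ A).
Proof.
move=> mA mf.
have mf' : measurable_fun (A : set (measurableTypeR R)) (f : measurableTypeR R -> R).
  have mf0 : measurable_fun (setT : set (measurableTypeR R)) (f : measurableTypeR R -> R) by exact: mf.
  exact: (measurable_funS measurableT (@subsetT _ A) mf0).
exact: ((@measurable_restrictT _ _ (measurableTypeR R) R A f mA).1 mf').
Qed.

Definition tail (R : realType) (N : R) : set R := [set x | N < `|x|].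

Lemma measurable_tail (R : realType) (N : R) : measurable (tail N : set (measurableTypeR R)).
Proof.
rewrite (_ : tail N = ~` `[- N, N]%classic).
  by apply: measurableC; exact: measurable_itv.
by apply/seteqP; split=> x; rewrite /tail /= in_itv/= -ler_norml ltNge => /negP.
Qed.

Lemma integrable_tail (R : realType) (q : R -> R) (e : R) :
  mu_L.-integrable setT (EFin \o q) -> 0 < e ->
  exists2 N : R, 0 < N & \int[mu_L]_x `|(q \_ (tail N)) x| < e.
Proof.
move=> iq e0.
have mq : measurable_fun setT q by apply/measurable_EFinP; exact: measurable_int iq.
pose q_ n x := `|(q \_ (tail (n.+1%:R))) x|%:E.
have mq_ n : measurable_fun setT (q_ n).
  apply/measurable_EFinP; apply: measurableT_comp => //.
  exact: measurable_restrictR (measurable_tail _) mq.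
have [] := @dominated_convergence _ _ R mu_L setT measurableT q_
    (cst 0%E) (fun x => `|q x|%:E).
- exact: mq_.
- exact: measurable_cst.
- apply: aeW => x _; apply: cvg_near_cst; near=> n.
  rewrite /q_ patchE memNset ?normr0// /tail /=; apply/negP; rewrite -leNgt.
  near: n; exists (Num.truncn `|x|) => // m /= tm.
  by apply: ltW; apply: lt_le_trans (truncnS_gt _) _; rewrite ler_nat.
- exact: integrable_norm iq.
- apply: aeW => x n _; rewrite /q_ /= lee_fin normr_id patchE.
  by case: ifP => // _; rewrite normr0.
move=> _ _; rewrite integral0 => /fine_cvgP[_ /cvgrPdist_lt/(_ _ e0)] [n _ /(_ n (leqnn _))].
rewrite /= sub0r normrN => h; exists n.+1%:R => //.
exact: le_lt_trans (ler_norm _) h.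
Unshelve. all: by end_near. Qed.

(** With [x] moved into [k], the integrand is continuous in [x] and dominated by [B * |f|], which
    gives continuity of the convolution. *)
Lemma conv_compact_C0 (R : realType) (f k : R -> R) (M B K : R) :
  mu_L.-integrable setT (EFin \o f) -> (forall x, `|f x| <= M) ->
  continuous k -> (forall x, `|k x| <= B) -> (forall x, K < `|x| -> k x = 0) ->
  C0 (Defs.conv f k).
Proof.
move=> fi fM ck kB kK.
have mf : measurable_fun setT f by apply/measurable_EFinP; exact: measurable_int fi.
have mk : measurable_fun setT k by exact: continuous_measurable_fun.
have mkr (x : R) : measurable_fun setT (fun t : R => k (x - t)).
  exact: (measurableT_comp mk (measurable_reflect x)).
have B0 : 0 <= B by exact: le_trans (kB 0).
have sf : sqint f by exact: bounded_sqint fi.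
have sk : sqint k.
  split=> //.
  have ik : mu_L.-integrable setT (EFin \o k).
    have iK : mu_L.-integrable `[- K, K] (EFin \o k).
      apply: continuous_compact_integrable; first exact: segment_compact.
      exact: continuous_subspaceT.
    apply: eq_integrableT ((integrable_mkcond _ _).1 iK); last exact: measurable_itv.
    move=> x; rewrite patchE; case: ifPn => //; rewrite notin_setE/= in_itv/= -ler_norml.
    by move/negP; rewrite -ltNge => /kK ->.
  by have [] := bounded_sqint kB ik.
have convE p x : sqint p -> Defs.conv p k x = \int[mu_L]_t (p t * k (x - t)).
  by move=> sp; apply: Rintegral_reflect_mul; exact: sqint_L2.
have ipk p x : mu_L.-integrable setT (EFin \o p) ->
    mu_L.-integrable setT (EFin \o (fun t : R => p t * k (x - t))).
  by move=> ip; exact: (integrableM_bounded ip (mkr x) (fun t => kB (x - t))).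
(* Cut off outside [[-N, N]], [f] has a convolution with [k] that vanishes beyond [N + K]. The tail
   of [f] contributes at most [B] times its L1 norm. *)
have decay e : 0 < e -> exists N, exists2 h : R -> R,
    (forall x, N < `|x| -> h x = 0) & forall x, `|Defs.conv f k x - h x| <= e.
  move=> e0; have [|N N0 HN] := @integrable_tail _ f (e / (B + 1)) fi.
    by rewrite divr_gt0// ltr_wpDl.
  have mt : measurable_fun setT (f \_ (tail N)).
    by apply: measurable_restrictR => //; exact: measurable_tail.
  have it : mu_L.-integrable setT (EFin \o (f \_ (tail N))).
    apply: le_integrable fi => //; first exact/measurable_EFinP.
    by move=> x _ /=; rewrite lee_fin patchE; case: ifP => // _; rewrite normr0.
  pose f' x := f x - (f \_ (tail N)) x.
  have i' : mu_L.-integrable setT (EFin \o f') by exact: (integrableB measurableT fi it).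
  exists (N + K), (fun x => \int[mu_L]_t (f' t * k (x - t))).
    move=> x NKx; rewrite (@eq_Rintegral _ _ _ mu_L setT (fun _ => 0)).
      by rewrite Rintegral_cst// mul0r.
    move=> t _; rewrite /f' patchE; case: ifPn => [|/negP tN].
      by rewrite subrr mul0r.
    rewrite kK ?mulr0//; have tN' : `|t| <= N.
      by rewrite leNgt; apply/negP => h; apply: tN; rewrite inE.
    by have := ler_normD (x - t) t; rewrite subrK; lra.
  move=> x; rewrite convE// -RintegralB//; [|exact: ipk..].
  rewrite (@eq_Rintegral _ _ _ mu_L setT (fun t => (f \_ (tail N)) t * k (x - t))); last first.
    by move=> t _; rewrite /f'; lra.
  apply: le_trans (normr_Rintegral_mul_le it (mkr x) (fun t => kB _)) _.
  move: HN; rewrite ltr_pdivlMr ?ltr_wpDl// => HN.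
  have : 0 <= \int[mu_L]_x0 `|(f \_ (tail N)) x0| by exact: Rintegral_ge0.
  by lra.
split.
- move=> x.
  have cvx : (x - 1 < x < x + 1) by apply/andP; split; lra.
  have -> : Defs.conv f k = fun x => \int[mu_L]_t (f t * k (x - t)).
    by apply/funext => y; exact: convE.
  apply: (@continuity_under_integral R _ _ mu_L (fun x t => f t * k (x - t)) setT measurableT
    (x - 1) (x + 1) _ _ (fun t => B * `|f t|)).
  + by move=> y _; exact: ipk.
  + apply: aeW => t _ y _; apply: cvgMr.
    apply: (@continuous_comp _ _ _ (fun y : R => y - t) k y); last exact: ck.
    by apply: cvgB; [exact: cvg_id|exact: cvg_cst].
  + by apply: (integrableZl measurableT B (integrable_norm fi)).
  + move=> y _; apply: aeW => t _; rewrite normrM mulrC ler_wpM2r//.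
  + by rewrite inE /= in_itv.
- apply: cvg_approx => e /decay[N [h hN hh]]; exists h, 0; split => //.
  + apply: cvg_near_cst; near=> x; apply: hN.
    apply: lt_le_trans _ (ler_norm x); near: x; apply: nbhs_pinfty_gt; exact: num_real.
  + by rewrite subrr normr0; exact: le_trans (hh 0).
- apply: cvg_approx => e /decay[N [h hN hh]]; exists h, 0; split => //.
  + apply: cvg_near_cst; near=> x; apply: hN.
    rewrite -normrN; apply: lt_le_trans _ (ler_norm (- x)).
    by rewrite ltrNr; near: x; apply: nbhs_ninfty_lt; exact: num_real.
  + by rewrite subrr normr0; exact: le_trans (hh 0).
Unshelve. all: by end_near. Qed.

Definition tent (R : realType) (N x : R) : R := Num.max 0 (Num.min 1 (N + 1 - `|x|)).

Lemma continuous_tent (R : realType) (N : R) : continuous (tent N).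
Proof.
rewrite (_ : tent N = cst 0 \max (cst 1 \min (fun x => N + 1 - `|x|))).
  move=> x; apply: continuous_max; first exact: cvg_cst.
  apply: continuous_min; first exact: cvg_cst.
  by apply: cvgB; [exact: cvg_cst|exact: norm_continuous].
by apply/funext => x.
Qed.

Lemma tent_bounds (R : realType) (N x : R) : 0 <= tent N x <= 1.
Proof. by rewrite /tent le_max lexx /= ge_max ler01 ge_min lexx. Qed.

Lemma tent_in (R : realType) (N x : R) : `|x| <= N -> tent N x = 1.
Proof. by move=> xN; rewrite /tent min_l ?max_r//; lra. Qed.

Lemma tent_out (R : realType) (N x : R) : N + 1 < `|x| -> tent N x = 0.
Proof. by move=> xN; rewrite /tent min_r ?max_l//; lra. Qed.

(** Multiplying a continuous approximation by a tent gives it compact support. The error does not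
    grow: the tent is 1 where [g] may be nonzero, and elsewhere it only shrinks the
    approximation. *)
Lemma L1_approx_compact (R : realType) (g : R -> R) (N e : R) :
  mu_L.-integrable setT (EFin \o g) -> (forall x, N < `|x| -> g x = 0) -> 0 < e ->
  exists k : R -> R, [/\ continuous k, exists B, forall x, `|k x| <= B,
    forall x, N + 1 < `|x| -> k x = 0, mu_L.-integrable setT (EFin \o k) &
    \int[mu_L]_x `|g x - k x| <= e].
Proof.
move=> ig gN e0; pose E : set (measurableTypeR R) := `[- (N + 1), N + 1]%classic.
have mE : measurable E by exact: measurable_itv.
have Efin : (mu_L E < +oo)%E.
  by rewrite /E lebesgue_measure_itv/=; case: ifP => // _; rewrite -EFinB ltry.
have igE : mu_L.-integrable E (EFin \o g) by exact: integrableS ig.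
have [h_ [ch ih hcv]] := approximation_continuous_integrable mE Efin igE.
have [n hn] : exists n, (\int[mu_L]_(z in E) `|(g z - h_ n z)%:E| < e%:E)%E.
  move/fine_cvgP : hcv => [[m _ fm] /cvgrPdist_lt/(_ _ e0)[m' _ hm]].
  exists (maxn m m'); have := hm (maxn m m') (leq_maxr _ _).
  have := fm (maxn m m') (leq_maxl _ _).
  rewrite /= sub0r normrN => fin /(le_lt_trans (ler_norm _)).
  by rewrite -lte_fin fineK.
pose k x := h_ n x * tent N x.
have ck : continuous k by move=> x; apply: cvgM; [exact: ch|exact: continuous_tent].
have kN x : N + 1 < `|x| -> k x = 0 by move=> Nx; rewrite /k tent_out// mulr0.
have outE x : ~ E x -> N + 1 < `|x|.
  by rewrite /E /= in_itv/= -ler_norml => /negP; rewrite -ltNge.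
have ik : mu_L.-integrable setT (EFin \o k).
  have iK : mu_L.-integrable E (EFin \o k).
    apply: continuous_compact_integrable; first exact: segment_compact.
    exact: continuous_subspaceT.
  apply: eq_integrableT ((integrable_mkcond _ mE).1 iK) => x.
  rewrite patchE; case: ifPn => //; rewrite notin_setE => /outE/kN.
  by move=> /= ->.
exists k; split => //.
  have [B [_ HB]] := compact_bounded (continuous_compact (continuous_subspaceT ck) (@segment_compact R (- (N + 1)) (N + 1))).
  exists (`|B| + 1) => x; have [Ex|/outE/kN ->] := pselect (E x); last first.
    by rewrite normr0 addr_ge0.
  apply: HB; first by rewrite (le_lt_trans (ler_norm _))// ltrDl.
  by exists x.
rewrite -lee_fin fineK; last first.
  apply: integrable_fin_num => //.
  exact: (@integrable_norm _ _ _ mu_L setT (fun x => g x - k x) (integrableB measurableT ig ik)).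
apply: le_trans (ltW hn).
rewrite integral_mkcond [leRHS]integral_mkcond.
have mg : measurable_fun setT g by apply/measurable_EFinP; exact: measurable_int ig.
have mk : measurable_fun setT k by exact: continuous_measurable_fun.
have mh : measurable_fun setT (h_ n) by exact: continuous_measurable_fun.
have mgh : measurable_fun setT (fun x => `|g x - h_ n x|).
  by apply: measurableT_comp => //; exact: measurable_funB.
have mghE := measurable_restrictR mE mgh.
rewrite patch_setT; apply: ge0_le_integral => //.
- apply/measurable_EFinP; apply: measurableT_comp => //; exact: measurable_funB.
- rewrite [X in measurable_fun _ X](_ : _ = EFin \o ((fun x => `|g x - h_ n x|) \_ E)).
    exact/measurable_EFinP.
  by rewrite -restrict_EFin.
move=> x _; rewrite patchE; case: ifPn => [_|].
  rewrite /= lee_fin /k; have [xN|Nx] := leP `|x| N; first by rewrite tent_in// mulr1.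
  rewrite gN// !sub0r !normrN normrM; have /andP[t0 t1] := tent_bounds N x.
  by rewrite (ger0_norm t0) ler_piMr.
rewrite notin_setE => /outE Nx; rewrite kN// gN ?subr0 ?normr0//.
by apply: lt_trans Nx; rewrite ltrDl.
Qed.

(* Split [g] into a tail, which is small in L2, and a part with compact support,
   which is close in L1 to a continuous function with compact support. As [f] is
   both square integrable and bounded, the convolution changes uniformly little. *)
Lemma conv_C0 (R : realType) (f g : R -> R) (M : R) :
  mu_L.-integrable setT (EFin \o f) -> (forall x, `|f x| <= M) -> sqint g ->
  C0 (Defs.conv f g).
Proof.
move=> fi fM sg; have [mg g2] := sg.
have sf : sqint f by exact: bounded_sqint fi.
have mf : measurable_fun setT f by case: sf.
have M0 : 0 <= M by exact: le_trans (fM 0).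
apply: C0_approx => e e0.
pose a := Num.sqrt (\int[mu_L]_t (f t * f t)).
have a0 : 0 <= a by exact: sqrtr_ge0.
(* The tail of [g] then has L2 norm at most [e / 2 / (a + 1)], and Cauchy-Schwarz multiplies this by
   [a], the L2 norm of [f]. *)
pose d := (e / 2 / (a + 1)) ^+ 2.
have d0' : 0 < e / 2 / (a + 1) by rewrite !divr_gt0// ltr_wpDl.
have d0 : 0 < d by rewrite exprn_gt0.
have [N N0 HN] := integrable_tail g2 d0.
have mt : measurable_fun setT (g \_ (tail N)).
  by apply: measurable_restrictR => //; exact: measurable_tail.
pose g1 := g \_ (tail N).
have E1 x : g1 x ^+ 2 = ((fun x => g x ^+ 2) \_ (tail N)) x.
  by rewrite /g1 !patchE; case: ifP => // _; rewrite expr0n.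
have s1 : sqint g1.
  split => //; apply: le_integrable g2 => //.
    by apply/measurable_EFinP; exact: measurable_funX.
  move=> x _ /=; rewrite lee_fin E1 patchE; case: ifP => // _.
  by rewrite normr0.
pose g2' x := g x - g1 x.
have s2 : sqint g2'.
  have := sqintD sg (sqintZ (-1) s1); rewrite (_ : (fun x => _ + _) = g2')//.
  by apply/funext => x; rewrite /g2'; lra.
have gN x : N < `|x| -> g2' x = 0.
  by move=> Nx; rewrite /g2' /g1 patchE mem_set// subrr.
have i2 : mu_L.-integrable setT (EFin \o g2').
  pose E : set (measurableTypeR R) := `[- N, N]%classic.
  have mE : measurable E by exact: measurable_itv.
  have Efin : (mu_L E < +oo)%E.
    by rewrite /E lebesgue_measure_itv/=; case: ifP => // _; rewrite -EFinB ltry.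
  apply: eq_integrableT ((integrable_mkcond _ mE).1 (sqint_integrable_on mE Efin s2)) => x.
  rewrite patchE; case: ifPn => //; rewrite notin_setE /E/= in_itv/= -ler_norml.
  by move/negP; rewrite -ltNge => /gN ->.
(* The L1 error allowed for [k]; the bound [M] of [f] turns it into at most [e / 2]. *)
have e2 : 0 < e / 2 / (M + 1) by rewrite !divr_gt0// ltr_wpDl.
have [k [ck [B kB] kN ik Hk]] := L1_approx_compact i2 gN e2.
exists (Defs.conv f k); first exact: conv_compact_C0 fi fM ck kB kN.
move=> x.
have sk : sqint k by exact: bounded_sqint kB ik.
have sfx : sqint (fun t => f (x - t)) by exact: sqint_reflect.
rewrite /Defs.conv -RintegralB//; [|exact: sqint_mul..].
rewrite (@eq_Rintegral _ _ _ mu_L setT (fun t => f (x - t) * g1 t + (g2' t - k t) * f (x - t))); last first.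
  by move=> t _; rewrite /g2'; lra.
have i3 : mu_L.-integrable setT (EFin \o (fun t => g2' t - k t)).
  exact: (integrableB measurableT i2 ik).
have mfx : measurable_fun setT (fun t : R => f (x - t)) by case: sfx.
have i4 : mu_L.-integrable setT (EFin \o (fun t : R => (g2' t - k t) * f (x - t))).
  exact: (integrableM_bounded i3 mfx (fun t => fM (x - t))).
rewrite RintegralD//; last exact: sqint_mul.
apply: le_trans (ler_normD _ _) _.
have h2 : `|\int[mu_L]_t ((g2' t - k t) * f (x - t))| <= e / 2.
  apply: le_trans (normr_Rintegral_mul_le i3 mfx (fun t => fM _)) _.
  move: Hk; rewrite ler_pdivlMr ?ltr_wpDl// => Hk.
  have : 0 <= \int[mu_L]_x0 `|g2' x0 - k x0| by exact: Rintegral_ge0.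
  by lra.
have h1 : `|\int[mu_L]_t (f (x - t) * g1 t)| <= e / 2.
  have := @cauchy_schwarz_sum R 1 (fun _ t => f (x - t)) (fun _ => g1) (fun _ => sfx) (fun _ => s1).
  rewrite !big_ord1 => /le_trans; apply.
  rewrite (Rintegral_reflect x (f := fun t => f t * f t)); last exact: measurable_funM.
  rewrite -/a.
  have : Num.sqrt (\int[mu_L]_t (g1 t * g1 t)) <= e / 2 / (a + 1).
    rewrite -(ger0_norm (ltW d0')) -sqrtr_sqr ler_wsqrtr// ltW//.
    apply: le_lt_trans HN; rewrite le_eqVlt; apply/orP; left; apply/eqP.
    by apply: eq_Rintegral => t _; rewrite -expr2 E1 ger0_norm// -E1 sqr_ge0.
  have := sqrtr_ge0 (\int[mu_L]_t (g1 t * g1 t)).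
  set b := Num.sqrt _ => b0; rewrite ler_pdivlMr ?ltr_wpDl// => hb.
  by lra.
lra.
Qed.

(** * Convolution with a finite measure *)

Lemma integrable_translate (R : realType) (y : R) (f : R -> R) :
  mu_L.-integrable setT (EFin \o f) ->
  mu_L.-integrable setT (EFin \o (fun x => f (x - y))).
Proof.
move=> /(integrable_reflect 0)/(integrable_reflect y); apply: eq_integrableT => x /=.
by congr (_ _)%:E; lra.
Qed.

Lemma ge0_integral_translate (R : realType) (y : R) (f : R -> \bar R) :
  measurable_fun setT f -> (forall t, 0 <= f t)%E ->
  (\int[mu_L]_x f (x - y)%R = \int[mu_L]_x f x)%E.
Proof.
move=> mf f0; rewrite -[RHS](ge0_integral_reflect 0 mf f0).
have mf0 : measurable_fun setT (fun t : R => f (0 - t)%R).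
  exact: (measurableT_comp mf (measurable_reflect 0)).
rewrite -[RHS](ge0_integral_reflect y mf0)//; apply: eq_integral => t _.
by congr f; lra.
Qed.

Lemma Rintegral_translate (R : realType) (y : R) (f : R -> R) :
  measurable_fun setT f -> \int[mu_L]_x f (x - y) = \int[mu_L]_x f x.
Proof.
move=> mf; rewrite -[RHS](Rintegral_reflect 0 mf).
have mf0 : measurable_fun setT (fun t : R => f (0 - t)).
  exact: (measurableT_comp mf (measurable_reflect 0)).
rewrite -[RHS](Rintegral_reflect y mf0); apply: eq_Rintegral => t _.
by congr f; lra.
Qed.

Lemma sqint_translate (R : realType) (y : R) (f : R -> R) :
  sqint f -> sqint (fun x => f (x - y)).
Proof.
move=> /(sqint_reflect 0)/(sqint_reflect y).
by congr sqint; apply/funext => x; congr f; lra.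
Qed.

Lemma bounded_finite_integrable d (T : measurableType d) (R : realType)
    (nu : {finite_measure set T -> \bar R}) (f : T -> R) (M : R) :
  measurable_fun setT f -> (forall x, `|f x| <= M) ->
  nu.-integrable setT (EFin \o f).
Proof.
move=> mf fM; apply: (@le_integrable _ _ _ nu setT measurableT _ (EFin \o cst M)).
- exact/measurable_EFinP.
- by move=> x _ /=; rewrite lee_fin (le_trans (fM x))// ler_norm.
- exact: finite_measure_integrable_cst.
Qed.

(** * Fubini's theorem for real-valued integrals *)

Section finite_fubini.
Context d1 d2 (T1 : measurableType d1) (T2 : measurableType d2) (R : realType).
Variable m1 : {sigma_finite_measure set T1 -> \bar R}.
Variable nu : {finite_measure set T2 -> \bar R}.
Variables (k : T1 * T2 -> R) (C : R).
Hypothesis mk : measurable_fun setT k.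
Hypothesis ik1 : forall y, m1.-integrable setT (EFin \o (fun x => k (x, y))).
Hypothesis kC : forall y, \int[m1]_x `|k (x, y)| <= C.

(** By Tonelli: the sections have L1 norm at most [C], and [nu] is finite. *)
Lemma integrable_bounded_section : (m1 \x nu)%E.-integrable setT (EFin \o k).
Proof.
have mk' : measurable_fun setT (EFin \o k) by exact/measurable_EFinP.
apply: (integrable21ltyP m1 nu mk').2.
apply: (@le_lt_trans _ _ (\int[nu]_y (cst C%:E) y)%E); last first.
  rewrite integral_cst//; apply: lte_mul_pinfty => //; last exact: fin_num_fun_lty.
  by rewrite lee_fin (le_trans _ (kC point))// Rintegral_ge0.
apply: ge0_le_integral => //.
- by move=> y _; exact: integral_ge0.
- apply: (@measurable_fun_fubini_tonelli_G _ _ T1 T2 R m1 (abse \o (EFin \o k))) => //.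
  exact: measurableT_comp.
- by move=> p; exact: abse_ge0.
move=> y _.
have := kC y; rewrite -lee_fin fineK//.
apply: integrable_fin_num => //.
exact: (integrable_norm (ik1 y)).
Qed.

Hypothesis ik2 : forall x, nu.-integrable setT (EFin \o (fun y => k (x, y))).

(** Every section being integrable, the inner integral is finite at every point and nothing is lost
    by [fine]. *)
Lemma integrable_Rintegral1 :
  m1.-integrable setT (EFin \o (fun x => \int[nu]_y k (x, y))).
Proof.
apply: eq_integrableT (integrable_fubini_F integrable_bounded_section) => x /=.
by rewrite /fubini_F /Rintegral fineK//; exact: (integrable_fin_num measurableT (ik2 x)).
Qed.

Lemma integrable_Rintegral2 :
  nu.-integrable setT (EFin \o (fun y => \int[m1]_x k (x, y))).
Proof.
apply: (@bounded_finite_integrable _ _ _ _ _ C); last first.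
  by move=> y; apply: le_trans (kC y); exact: le_normr_Rintegral (ik1 y).
apply/measurable_EFinP; rewrite (_ : EFin \o _ = fubini_G m1 (EFin \o k)).
  exact: measurable_fubini_G integrable_bounded_section.
apply/funext => y; rewrite /fubini_G /= /Rintegral fineK//.
exact: (integrable_fin_num measurableT (ik1 y)).
Qed.

Lemma Rintegral_fubini :
  \int[m1]_x \int[nu]_y k (x, y) = \int[nu]_y \int[m1]_x k (x, y).
Proof.
congr fine; transitivity (\int[m1]_x \int[nu]_y (k (x, y))%:E)%E.
  by apply: eq_integral => x _; rewrite /Rintegral fineK//; exact: (integrable_fin_num measurableT (ik2 x)).
rewrite (Fubini integrable_bounded_section).
by apply: eq_integral => y _; rewrite /Rintegral fineK//; exact: (integrable_fin_num measurableT (ik1 y)).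
Qed.

End finite_fubini.

Section conv_finite_measure.
Context (R : realType) (nu : {finite_measure set (measurableTypeR R) -> \bar R}).
Implicit Types f g : R -> R.

Lemma measurable_sub_prod f : measurable_fun setT f ->
  measurable_fun setT (fun p : measurableTypeR R * measurableTypeR R => f (p.1 - p.2)).
Proof.
move=> mf; apply: (measurableT_comp (mf : measurable_fun setT (f : measurableTypeR R -> R))).
by apply: measurable_funB; [exact: measurable_fst|exact: measurable_snd].
Qed.

Lemma bounded_integrable_reflect f (M x : R) : measurable_fun setT f ->
  (forall t, `|f t| <= M) -> nu.-integrable setT (EFin \o (fun y => f (x - y))).
Proof.
move=> mf fM; apply: (@bounded_finite_integrable _ _ _ nu (fun y : R => f (x - y)) M) => //.
exact: (measurableT_comp mf (measurable_reflect x)).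
Qed.

(** Bounded by [M] times the mass of [nu], and integrable by Fubini, since all translates of [f]
    have the same L1 norm. *)
Lemma sqint_conv_finite f (M : R) : mu_L.-integrable setT (EFin \o f) ->
  (forall x, `|f x| <= M) -> sqint (fun x => \int[nu]_y f (x - y)).
Proof.
move=> fi fM.
have mf : measurable_fun setT f by apply/measurable_EFinP; exact: measurable_int fi.
apply: (@bounded_sqint _ _ (fine (nu setT) * M)).
  move=> x; have inx := bounded_integrable_reflect x mf fM.
  apply: le_trans (le_normr_Rintegral _ inx) _ => //.
  rewrite mulrC -(@Rintegral_cst _ _ _ nu setT)//; apply: le_Rintegral => //.
    exact: integrable_norm.
  exact: finite_measure_integrable_cst.
apply: (@integrable_Rintegral1 _ _ _ _ R mu_L nu (fun p => f (p.1 - p.2)) (\int[mu_L]_x `|f x|)).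
- exact: measurable_sub_prod.
- by move=> y; exact: integrable_translate.
- move=> y; rewrite (Rintegral_translate y (f := fun x => `|f x|))//.
  exact: measurableT_comp.
- by move=> x; exact: bounded_integrable_reflect.
Qed.

Lemma conv_finite_fubini f g (M : R) : mu_L.-integrable setT (EFin \o f) ->
  (forall x, `|f x| <= M) -> sqint g ->
  nu.-integrable setT (EFin \o (fun y => \int[mu_L]_x (f (x - y) * g x))) /\
  \int[mu_L]_x ((\int[nu]_y f (x - y)) * g x) =
  \int[nu]_y \int[mu_L]_x (f (x - y) * g x).
Proof.
move=> fi fM sg; have [mg g2] := sg.
have mf : measurable_fun setT f by apply/measurable_EFinP; exact: measurable_int fi.
have sf : sqint f by exact: bounded_sqint fi.
pose k (p : measurableTypeR R * measurableTypeR R) : R := f (p.1 - p.2) * g p.1.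
(* A product is bounded by the sum of the squares, and translation invariance makes the resulting
   bound independent of [y]. *)
pose C := \int[mu_L]_x (f x ^+ 2) + \int[mu_L]_x (g x ^+ 2).
have mk : measurable_fun setT k.
  apply: measurable_funM; first exact: measurable_sub_prod.
  exact: (measurableT_comp (mg : measurable_fun setT (g : measurableTypeR R -> R)) measurable_fst).
have ik1 y : mu_L.-integrable setT (EFin \o (fun x => k (x, y))).
  exact: (sqint_mul (sqint_translate y sf) sg).
have kC y : \int[mu_L]_x `|k (x, y)| <= C.
  have [_ fy2] := sqint_translate y sf; rewrite /C.
  rewrite -(Rintegral_translate y (f := fun x => f x ^+ 2)); last exact: measurable_funX.
  rewrite -RintegralD//; apply: le_Rintegral => //.
  - exact: integrable_norm (ik1 y).
  - exact: (integrableD measurableT fy2 g2).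
  - move=> x _; rewrite /k /= normrM; have := sqr_ge0 (`|f (x - y)| - `|g x|).
    rewrite -(real_normK (num_real (f (x - y)))) -(real_normK (num_real (g x))).
    have := normr_ge0 (f (x - y)); have := normr_ge0 (g x); nra.
have ik2 x : nu.-integrable setT (EFin \o (fun y => k (x, y))).
  have := integrableZl measurableT (g x) (bounded_integrable_reflect x mf fM).
  by apply: eq_integrableT => y /=; rewrite /k /= mulrC.
split; first exact: (@integrable_Rintegral2 _ _ _ _ R mu_L nu k C mk ik1 kC).
rewrite -(Rintegral_fubini mk ik1 kC ik2); apply: eq_Rintegral => x _.
by rewrite -RintegralZr//; exact: bounded_integrable_reflect fM.
Qed.

(** [nu] may charge the exceptional null set [N], so equality can fail at some [x]. Translates of
    [N] are Lebesgue null; by Tonelli, for almost every [x] the set of [y] with [x - y] in [N] is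
    [nu]-null. *)
Lemma conv_finite_ae f g : measurable_fun setT f -> ae_eq mu_L setT g f ->
  ae_eq mu_L setT (fun x => \int[nu]_y g (x - y)) (fun x => \int[nu]_y f (x - y)).
Proof.
move=> mf [N [mN N0 PN]].
pose h (p : measurableTypeR R * measurableTypeR R) : R := \1_N (p.1 - p.2).
have mh : measurable_fun setT (EFin \o h).
  apply/measurable_EFinP; apply: (@measurable_sub_prod (\1_N)).
  exact: measurable_indic.
have h0 p : (0 <= (EFin \o h) p)%E by rewrite lee_fin.
have mh1 := @measurable_fun_fubini_tonelli_F _ _ (measurableTypeR R) (measurableTypeR R) R nu _ mh h0.
have := @fubini_tonelli _ _ (measurableTypeR R) (measurableTypeR R) R mu_L nu _ mh h0.
rewrite [RHS]integral0_eq; last first.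
  move=> y _; rewrite /h /=.
  rewrite (ge0_integral_translate y (f := fun t => (\1_(N : set R) t : R)%:E))//; last first.
    by apply/measurable_EFinP; exact: measurable_indic.
  by rewrite integral_indic// setIT.
move=> h1.
have : ae_eq mu_L setT (fun x => \int[nu]_y (EFin \o h) (x, y))%E (cst 0%E).
  apply/(ae_eq_integral_abs mu_L measurableT mh1).
  rewrite -[RHS]h1; apply: eq_integral => x _; rewrite gee0_abs//.
  exact: integral_ge0.
rewrite /ae_eq => H; apply: (ae_lebesgue_mono H) => x /(_ I) /= hx _.
apply: ae_eq_Rintegral.
have mhx : measurable_fun setT (fun y : measurableTypeR R => (EFin \o h) (x, y)).
  by apply: measurableT_comp => //; exact: pair1_measurable.
have : ae_eq nu setT (fun y => (EFin \o h) (x, y)) (cst 0%E).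
  apply/(ae_eq_integral_abs nu measurableT mhx).
  by rewrite -[RHS]hx; apply: eq_integral => y _; rewrite gee0_abs.
apply: filterS => y /(_ I) /= hxy _; apply: contrapT => gf.
have : N (x - y) by apply: PN => /(_ I).
by move: hxy; rewrite /h indicE => /eqP; rewrite eqe pnatr_eq0 eqb0 notin_setE.
Qed.

End conv_finite_measure.

(** * Convolution with a signed measure *)

(** One pair of finite measures serves all integrands, which reduces signed measures to the
    preceding results. *)
Lemma signed_integral_finite (R : realType) (mu : signed_measure R) :
  exists nu1 nu2 : {finite_measure set (measurableTypeR R) -> \bar R},
    forall f : R -> R, signed_integral mu f = \int[nu1]_y f y - \int[nu2]_y f y.
Proof.
pose hahn := projT2 (cid (projT2 (cid (Hahn_decomposition mu)))).
by exists (jordan_pos hahn), (jordan_neg hahn).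
Qed.

Section conv_signed_measure.
Context (R : realType) (mu : signed_measure R).
Implicit Types f g : R -> R.

Lemma sqint_conv_measure f (M : R) : mu_L.-integrable setT (EFin \o f) ->
  (forall x, `|f x| <= M) -> sqint (conv_measure f mu).
Proof.
move=> fi fM; have [nu1 [nu2 H]] := signed_integral_finite mu.
have := sqintD (sqint_conv_finite nu1 fi fM) (sqintZ (-1) (sqint_conv_finite nu2 fi fM)).
by congr sqint; apply/funext => x; rewrite /conv_measure H; lra.
Qed.

Lemma conv_measure_ae f g : measurable_fun setT f -> ae_eq mu_L setT g f ->
  ae_eq mu_L setT (conv_measure g mu) (conv_measure f mu).
Proof.
move=> mf gf; have [nu1 [nu2 H]] := signed_integral_finite mu.
rewrite /ae_eq; apply: (ae_lebesgue_mono2 (conv_finite_ae nu1 mf gf) (conv_finite_ae nu2 mf gf)).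
by move=> x /(_ I) h1 /(_ I) h2 _; rewrite /conv_measure !H h1 h2.
Qed.

(** The dual map integrates a sum of convolutions. Fubini makes each term integrable for both finite
    measures, so that the integral of the sum splits. *)
Lemma conv_measure_fubini_sum (n : nat) (f g : 'I_n -> R -> R) (M : 'I_n -> R) :
  (forall k, mu_L.-integrable setT (EFin \o f k)) ->
  (forall k x, `|f k x| <= M k) -> (forall k, sqint (g k)) ->
  \sum_(k < n) \int[mu_L]_x (conv_measure (f k) mu x * g k x) =
  signed_integral mu (fun y => \sum_(k < n) \int[mu_L]_x (f k (x - y) * g k x)).
Proof.
move=> fi fM sg; have [nu1 [nu2 H]] := signed_integral_finite mu.
have E (nu : {finite_measure set (measurableTypeR R) -> \bar R}) :
    \int[nu]_y (\sum_(k < n) \int[mu_L]_x (f k (x - y) * g k x)) =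
    \sum_(k < n) \int[nu]_y \int[mu_L]_x (f k (x - y) * g k x).
  apply: (@Rintegral_sum _ _ R nu n (fun k (y : R) => \int[mu_L]_x (f k (x - y) * g k x))) => k.
  by have [] := conv_finite_fubini nu (fi k) (fM k) (sg k).
rewrite H !E.
rewrite -sumrB; apply: eq_bigr => k _.
have [_ <-] := conv_finite_fubini nu1 (fi k) (fM k) (sg k).
have [_ <-] := conv_finite_fubini nu2 (fi k) (fM k) (sg k).
rewrite -RintegralB//; last 2 first.
- exact: (sqint_mul (sqint_conv_finite nu1 (fi k) (fM k)) (sg k)).
- exact: (sqint_mul (sqint_conv_finite nu2 (fi k) (fM k)) (sg k)).
by apply: eq_Rintegral => x _; rewrite /conv_measure H mulrBl.
Qed.

Lemma conv_measure_fubini f g (M : R) : mu_L.-integrable setT (EFin \o f) ->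
  (forall x, `|f x| <= M) -> sqint g ->
  \int[mu_L]_x (conv_measure f mu x * g x) =
  signed_integral mu (fun y => \int[mu_L]_x (f (x - y) * g x)).
Proof.
move=> fi fM sg.
have := @conv_measure_fubini_sum 1 (fun _ => f) (fun _ => g) (fun _ => M) (fun _ => fi)
  (fun _ => fM) (fun _ => sg).
rewrite big_ord1 => ->; congr signed_integral; apply/funext => y.
by rewrite big_ord1.
Qed.

End conv_signed_measure.

(** * Kernels of the convolution operators *)

Lemma regular_kernel (R : realType) (n : nat) (G : R -> R) : regular n G ->
  exists (f : nat -> R -> R) (M : nat -> R), forall k, (k <= n)%N ->
  [/\ mu_L.-integrable setT (EFin \o f k), forall x, `|f k x| <= M k &
      ae_eq mu_L setT (derive1n k G) (f k)].
Proof.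
move=> rG.
have H k : exists fM : (R -> R) * R, (k <= n)%N ->
  [/\ mu_L.-integrable setT (EFin \o fM.1), forall x, `|fM.1 x| <= fM.2 &
      ae_eq mu_L setT (derive1n k G) fM.1].
  have [kn|kn] := boolP (k <= n)%N; last by exists (cst 0, 0).
  by have [f [M H]] := regular_repr rG kn; exists (f, M).
have [F HF] := choice H.
by exists (fun k => (F k).1), (fun k => (F k).2).
Qed.

Lemma reflect_at0_even (R : realType) (G : R -> R) : even_fun G -> reflect_at G 0 = G.
Proof. by move=> eG; apply/funext => t; rewrite /reflect_at sub0r. Qed.

(* Evenness of [G] gives [w (- t) = (-1) ^+ k * w t] almost everywhere. *)
Lemma even_weak_derive_reflect (R : realType) (k : nat) (G w : R -> R) (y : R) :
  even_fun G -> is_weak_derive k G w ->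
  is_weak_derive k (reflect_at G y) (fun x => w (x - y)).
Proof.
move=> eG Gw; have Gwy := is_weak_derive_reflect y Gw.
apply: is_weak_derive_ae Gwy; first exact: ae_eq_refl.
have := is_weak_derive_reflect 0 Gw; rewrite reflect_at0_even// => Gw0.
pose P s := setT s -> (-1) ^+ k * w (0 - s) = w s.
have h := ae_reflect (P := P) y (weak_derive_unique Gw0 Gw).
rewrite /ae_eq; apply: (ae_lebesgue_mono h) => x /(_ I) {}h _.
rewrite -h mulrA -expr2 sqrr_sign mul1r; congr w; lra.
Qed.

(** * The inner product of the Sobolev space *)

Lemma Rintegral_L2Z (R : realType) (a : R) (u w : R -> R) : L2 u -> L2 w ->
  \int[mu_L]_x (a * u x * w x) = a * \int[mu_L]_x (u x * w x).
Proof.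
(* [a u] is written as [(a - 1) u + u] to fit the linearity lemma. *)
move=> Lu Lw; have := Rintegral_L2_lin (a - 1) Lu Lu Lw.
rewrite mulrBl mul1r subrK => <-; apply: eq_Rintegral => x _.
by rewrite mulrBl mul1r subrK.
Qed.

Lemma sobolev_repr (R : realType) (n : nat) (u : R -> R) : sobolev n u ->
  exists U : nat -> R -> R, forall k, (k <= n)%N ->
    sqint (U k) /\ is_weak_derive k u (U k).
Proof.
move=> su; have H k : exists U : R -> R, (k <= n)%N -> sqint U /\ is_weak_derive k u U.
  have [kn|kn] := boolP (k <= n)%N; last by exists (cst 0).
  have uw := sobolevP su kn; have [_ /L2P[U sU wU] _] := uw.
  by exists U => _; split=> //; exact: is_weak_derive_ae (ae_eq_refl _ _ _) wU uw.
by have [U HU] := choice H; exists U.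
Qed.

Section sobolev_inner_product.
Context (R : realType) (n : nat).
Implicit Types (u v w : R -> R) (a : R).

Lemma sobolev_lin a u v : sobolev n u -> sobolev n v -> sobolev n (a *: u + v).
Proof.
move=> su sv k kn; have [w uw] := su k kn; have [w' vw] := sv k kn.
by exists (fun x => a * w x + w' x); exact: is_weak_derive_lin.
Qed.

Lemma sobolev_innerC u v : sobolev_inner n u v = sobolev_inner n v u.
Proof. by apply: eq_bigr => k _; apply: eq_Rintegral => t _; rewrite mulrC. Qed.

Lemma sobolev_inner_ael u v w : ae_eq mu_L setT u v ->
  sobolev_inner n u w = sobolev_inner n v w.
Proof. by move=> uv; apply: eq_bigr => k _; rewrite (weak_derive_ae k uv). Qed.

Lemma sobolev_inner_linl a u v w : sobolev n u -> sobolev n v -> sobolev n w ->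
  sobolev_inner n (a *: u + v) w = a * sobolev_inner n u w + sobolev_inner n v w.
Proof.
move=> su sv sw; rewrite mulr_sumr -big_split/=.
rewrite (@sobolev_innerE _ n _ w
  (fun k x => a * weak_derive k u x + weak_derive k v x) (fun k => weak_derive k w)).
- apply: eq_bigr => k _; have kn : (k <= n)%N by rewrite -ltnS.
  have [_ Lu _] := sobolevP su kn; have [_ Lv _] := sobolevP sv kn.
  by have [_ Lw _] := sobolevP sw kn; exact: Rintegral_L2_lin.
- by move=> k kn; exact: (is_weak_derive_lin a (sobolevP su kn) (sobolevP sv kn)).
- by move=> k kn; exact: (sobolevP sw kn).
Qed.

Lemma sobolev_inner_linr a u v w : sobolev n u -> sobolev n v -> sobolev n w ->
  sobolev_inner n w (a *: u + v) = a * sobolev_inner n w u + sobolev_inner n w v.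
Proof.
move=> su sv sw.
by rewrite (sobolev_innerC w) (sobolev_inner_linl a su sv sw) (sobolev_innerC u) (sobolev_innerC v).
Qed.

Lemma sobolev_inner_ge0 u : 0 <= sobolev_inner n u u.
Proof.
by apply: sumr_ge0 => k _; apply: Rintegral_ge0 => t _; rewrite -expr2 sqr_ge0.
Qed.

Lemma sobolev_cauchy_schwarz u v : sobolev n u -> sobolev n v ->
  `|sobolev_inner n u v| <= sobolev_norm n u * sobolev_norm n v.
Proof.
move=> /sobolev_repr[U HU] /sobolev_repr[V HV].
have hU k : (k <= n)%N -> is_weak_derive k u (U k) by move=> /HU[].
have hV k : (k <= n)%N -> is_weak_derive k v (V k) by move=> /HV[].
rewrite /sobolev_norm (sobolev_innerE hU hV) (sobolev_innerE hU hU) (sobolev_innerE hV hV).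
apply: (@cauchy_schwarz_sum R n.+1 (fun k => U k) (fun k => V k)) => k.
- by have [] := HU k (ltn_ord k).
- by have [] := HV k (ltn_ord k).
Qed.

(** All terms of the sum are nonnegative, so the one of order 0 vanishes; it is the squared L2 norm
    of a representative of [u]. *)
Lemma sobolev_inner_definite u : sobolev n u -> sobolev_inner n u u = 0 ->
  ae_eq mu_L setT u (cst 0).
Proof.
move=> su; have [U HU] := sobolev_repr su.
have hU k : (k <= n)%N -> is_weak_derive k u (U k) by move=> /HU[].
rewrite (sobolev_innerE hU hU) => /eqP; rewrite psumr_eq0; last first.
  by move=> k _; apply: Rintegral_ge0 => t _; rewrite -expr2 sqr_ge0.
move=> /allP/(_ ord0 (mem_index_enum _))/eqP/= int0.
have [[mU U2] uU] := HU 0%N (leq0n n).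
have [Lu _ _] := uU.
have uU0 : ae_eq mu_L setT u (U 0%N) := weak_derive_unique (is_weak_derive0 Lu) uU.
have m2 : measurable_fun setT (EFin \o (fun x => U 0%N x ^+ 2)) by exact: measurable_int U2.
have : ae_eq mu_L setT (EFin \o (fun x => U 0%N x ^+ 2)) (cst 0%E).
  apply/(ae_eq_integral_abs mu_L measurableT m2).
  transitivity (\int[mu_L]_x (U 0%N x ^+ 2)%:E)%E.
    by apply: eq_integral => x _; rewrite gee0_abs// lee_fin sqr_ge0.
  rewrite -[LHS]fineK; last exact: integrable_fin_num U2.
  by congr EFin; rewrite -[RHS]int0; apply: eq_Rintegral => x _; rewrite expr2.
rewrite /ae_eq => U0; apply: (ae_lebesgue_mono2 uU0 U0) => x /(_ I) -> /(_ I) /= h _.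
by move: h => /eqP; rewrite eqe sqrf_eq0 => /eqP.
Qed.

End sobolev_inner_product.

Lemma C0_lin (R : realType) (a : R) (g h : R -> R) :
  C0 g -> C0 h -> C0 (fun x => a * g x + h x).
Proof.
move=> [cg g1 g2] [ch h1 h2].
have H (F : set_system R) (l m : R) : Filter F -> g x @[x --> F] --> l -> h x @[x --> F] --> m ->
    (a * g x + h x) @[x --> F] --> a * l + m.
  by move=> FF gl hm; apply: cvgD => //; apply: cvgM => //; exact: cvg_cst.
have E : a * 0 + 0 = 0 :> R by rewrite mulr0 addr0.
split; first by move=> x; apply: H; [exact: cg|exact: ch].
- by rewrite -[X in _ --> X]E; apply: H.
- by rewrite -[X in _ --> X]E; apply: H.
Qed.

Lemma C0_sum (R : realType) (n : nat) (a : nat -> R) (h : nat -> R -> R) :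
  (forall k, (k < n)%N -> C0 (h k)) -> C0 (fun x => \sum_(k < n) a k * h k x).
Proof.
elim: n => [_|n IH H].
  rewrite (_ : (fun _ => _) = cst 0); last by apply/funext => x; rewrite big_ord0.
  by split; [move=> x|..]; exact: cvg_cst.
rewrite (_ : (fun _ => _) = fun x => a n * h n x + \sum_(k < n) a k * h k x).
  by apply: C0_lin; [exact: H|apply: IH => k kn; exact/H/ltnW].
by apply/funext => x; rewrite big_ord_recr/= addrC.
Qed.

(** * The operator *)

Section regular_operator.
Context (R : realType) (n : nat) (G : R -> R).
Hypotheses (eG : even_fun G) (rG : regular n G).
Implicit Types (u v : R -> R).

Let Gw k : (k <= n)%N -> is_weak_derive k G (derive1n k G).
Proof. exact: regular_weak_derive. Qed.

Lemma sobolev_reflect x : sobolev n (reflect_at G x).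
Proof.
by move=> k kn; exists (fun t => derive1n k G (t - x)); exact/even_weak_derive_reflect/Gw.
Qed.

Lemma conv_op_inner u x : sobolev n u ->
  conv_op n G u x = sobolev_inner n (reflect_at G x) u.
Proof.
move=> su; rewrite (@sobolev_innerE _ n _ u
  (fun k t => (-1) ^+ k * derive1n k G (x - t)) (fun k => weak_derive k u)).
- apply: eq_bigr => k _; have kn : (k <= n)%N by rewrite -ltnS.
  have [_ LG _] := Gw kn; have [_ Lu _] := sobolevP su kn.
  by rewrite (Rintegral_L2Z _ (L2_reflect x LG) Lu).
- by move=> k kn; exact/is_weak_derive_reflect/Gw.
- by move=> k kn; exact: (sobolevP su kn).
Qed.

Lemma conv_op_C0 u : sobolev n u -> C0 (conv_op n G u).
Proof.
move=> su; have [U HU] := sobolev_repr su; have [f [M Hf]] := regular_kernel rG.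
(* This equality holds at every [x]: convolution integrates against Lebesgue measure, which ignores
   the change of representatives. *)
have -> : conv_op n G u = fun x => \sum_(k < n.+1) (-1) ^+ k * Defs.conv (f k) (U k) x.
  apply/funext => x; apply: eq_bigr => k _; congr (_ * _).
  have kn : (k <= n)%N by rewrite -ltnS.
  have [_ uU] := HU k kn; have [_ _ Gf] := Hf k kn.
  apply: ae_eq_Rintegral; rewrite /ae_eq.
  have h := ae_reflect (P := fun t => setT t -> derive1n k G t = f k t) x Gf.
  by apply: (ae_lebesgue_mono2 h (weak_deriveE uU)) => t /(_ I) -> /(_ I) ->.
apply: (@C0_sum _ n.+1 (fun k => (-1) ^+ k) (fun k => Defs.conv (f k) (U k))) => k kn.
by have [sU _] := HU k kn; have [fi fM _] := Hf k kn; exact: conv_C0 fi fM sU.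
Qed.

Lemma conv_op_respects_ae : respects_ae n (conv_op n G).
Proof.
move=> u v _ uv; apply/funext => x; apply: eq_bigr => k _.
by rewrite (weak_derive_ae k uv).
Qed.

(** Read off the inner product, because [weak_derive] of a combination is the combination only
    almost everywhere. *)
Lemma conv_op_linear : linear_on_sobolev n (conv_op n G).
Proof.
move=> a u v su sv; apply/funext => x.
transitivity (a * conv_op n G u x + conv_op n G v x) => //.
rewrite (conv_op_inner x su) (conv_op_inner x sv) (conv_op_inner x (sobolev_lin a su sv)).
exact: (sobolev_inner_linr a su sv (sobolev_reflect x)).
Qed.

(** By evenness the weak derivatives of [reflect_at G x] are the translates [f k (t - x)], and
    Lebesgue measure is translation invariant. *)
Lemma sobolev_norm_reflect x : sobolev_norm n (reflect_at G x) = sobolev_norm n G.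
Proof.
have [f [M Hf]] := regular_kernel rG.
have Gwf k : (k <= n)%N -> is_weak_derive k G (f k).
  by move=> kn; have [_ _ Gf] := Hf k kn; exact: is_weak_derive_ae (ae_eq_refl _ _ _) Gf (Gw kn).
have Gx k (kn : (k <= n)%N) := even_weak_derive_reflect x eG (Gwf k kn).
rewrite /sobolev_norm (sobolev_innerE Gwf Gwf) (sobolev_innerE Gx Gx).
congr (Num.sqrt _); apply: eq_bigr => k _.
apply: (@Rintegral_translate R x (fun t => f k t * f k t)).
have [fi _ _] := Hf k (ltn_ord k); apply: measurable_funM;
  by apply/measurable_EFinP; exact: measurable_int fi.
Qed.

Lemma sup_norm_conv_op u : sobolev n u ->
  (sup_norm (conv_op n G u) <= (sobolev_norm n G * sobolev_norm n u)%:E)%E.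
Proof.
move=> su; apply: ge_ereal_sup => _ [x _ <-]; rewrite lee_fin.
rewrite conv_op_inner// -(sobolev_norm_reflect x).
by apply: sobolev_cauchy_schwarz => //; exact: sobolev_reflect.
Qed.

Lemma op_norm_conv_op : op_norm n (conv_op n G) = (sobolev_norm n G)%:E.
Proof.
have sG : sobolev n G by have := sobolev_reflect 0; rewrite reflect_at0_even.
have N0 : 0 <= sobolev_norm n G by exact: sqrtr_ge0.
apply/eqP; rewrite eq_le; apply/andP; split.
  apply: ge_ereal_sup => _ [u [su u1] <-].
  by apply: le_trans (sup_norm_conv_op su) _; rewrite lee_fin ler_piMr.
(* The supremum is attained at [G] divided by its norm. If the norm is 0 then
   [c = 0], and the computation remains valid. *)
pose c := (sobolev_norm n G)^-1; pose u := (c - 1) *: G + G.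
(* [u] is [c *: G], in the shape [a *: u + v] of the linearity lemmas. *)
have su : sobolev n u by exact: sobolev_lin.
have N2 : sobolev_inner n G G = sobolev_norm n G ^+ 2.
  by rewrite sqr_sqrtr// sobolev_inner_ge0.
have Gu : sobolev_inner n G u = c * sobolev_norm n G ^+ 2.
  by rewrite (sobolev_inner_linr (c - 1) sG sG sG) N2; lra.
have cN : c * sobolev_norm n G ^+ 2 = sobolev_norm n G.
  have [->|Nn0] := eqVneq (sobolev_norm n G) 0; first by rewrite expr0n mulr0.
  by rewrite /c expr2 mulrA mulVf// mul1r.
have u1 : sobolev_norm n u <= 1.
  have uu : sobolev_inner n u u = c * sobolev_norm n G.
    by rewrite (sobolev_inner_linl (c - 1) sG sG su) Gu cN mulrBl mul1r subrK.
  rewrite [sobolev_norm n u]/sobolev_norm uu.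
  rewrite -sqrtr1 ler_wsqrtr//.
  have [->|Nn0] := eqVneq (sobolev_norm n G) 0; first by rewrite mulr0.
  by rewrite /c mulVf.
apply: (@le_trans _ _ (sup_norm (conv_op n G u))); last first.
  by apply: ereal_sup_ubound; exists u.
apply: (@le_trans _ _ `|conv_op n G u 0|%:E); last by apply: ereal_sup_ubound; exists 0.
by rewrite conv_op_inner// reflect_at0_even// Gu cN lee_fin ler_norm.
Qed.

Section dual.
Variable mu : signed_measure R.
Variables (f : nat -> R -> R) (M : nat -> R).
Hypothesis Hf : forall k, (k <= n)%N ->
  [/\ mu_L.-integrable setT (EFin \o f k), forall x, `|f k x| <= M k &
      ae_eq mu_L setT (derive1n k G) (f k)].

Let Gwf k : (k <= n)%N -> is_weak_derive k G (f k).
Proof.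
by move=> kn; have [_ _ Gf] := Hf kn; exact: is_weak_derive_ae (ae_eq_refl _ _ _) Gf (Gw kn).
Qed.

(** Fubini reduces the claim to the integrands in [y], where it says that [f k (x - y)] is a weak
    derivative of the translate of [G] by [y]. *)
Lemma conv_measure_weak_derive k : (k <= n)%N ->
  is_weak_derive k (conv_measure G mu) (conv_measure (f k) mu).
Proof.
move=> kn; have [fi0 fM0 Gf0] := Hf (leq0n n); have [fi fM _] := Hf kn.
have mf0 : measurable_fun setT (f 0%N) by apply/measurable_EFinP; exact: measurable_int fi0.
have L2f : L2 (conv_measure (f k) mu) by exact: sqint_L2 (sqint_conv_measure mu fi fM).
have GC := conv_measure_ae mu mf0 Gf0.
split => //.
  exact: L2_ae (ae_eq_sym GC) (sqint_L2 (sqint_conv_measure mu fi0 fM0)).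
move=> phi tp; have sp := test_fun_sqint tp; have sp' := test_fun_sqint (test_fun_derive1n k tp).
rewrite (ae_eq_Rintegral (ae_eq_mulr _ GC)) (conv_measure_fubini mu fi0 fM0 sp').
rewrite -(Rintegral_L2Z _ L2f (sqint_L2 sp)).
transitivity (\int[mu_L]_t (conv_measure (f k) mu t * ((-1) ^+ k * phi t))); last first.
  by apply: eq_Rintegral => t _; rewrite mulrCA mulrA.
rewrite (conv_measure_fubini mu fi fM (sqintZ _ sp)); congr signed_integral; apply/funext => y.
(* The identity holds for every [y], not just almost every one, as integration against [mu]
   demands. *)
have [Lr Lfy H] := even_weak_derive_reflect y eG (Gwf kn).
have h0 := even_weak_derive_reflect y eG (Gwf (leq0n n)).
have := H _ tp; rewrite (ae_eq_Rintegral (ae_eq_mulr _ (weak_derive_unique (is_weak_derive0 Lr) h0))).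
move=> ->; rewrite -(Rintegral_L2Z _ Lfy (sqint_L2 sp)).
by apply: eq_Rintegral => t _; rewrite mulrAC mulrC mulrCA mulrA.
Qed.

Lemma sobolev_inner_conv_measure u : sobolev n u ->
  sobolev_inner n (conv_measure G mu) u = dual_map (conv_op n G) mu u.
Proof.
move=> su; have [U HU] := sobolev_repr su.
have hU k : (k <= n)%N -> is_weak_derive k u (U k) by move=> /HU[].
rewrite (sobolev_innerE conv_measure_weak_derive hU).
rewrite (@conv_measure_fubini_sum _ mu n.+1 (fun k => f k) (fun k => U k) (fun k => M k)).
- congr signed_integral; apply/funext => y; rewrite conv_op_inner//.
  rewrite (sobolev_innerE (U := fun k x => f k (x - y)) _ hU)// => k kn.
  exact/even_weak_derive_reflect/Gwf.
- by move=> k; have [] := Hf (ltn_ord k).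
- by move=> k; have [] := Hf (ltn_ord k).
- by move=> k; have [] := HU k (ltn_ord k).
Qed.

End dual.

Lemma riesz_conv_measure (mu : signed_measure R) v :
  riesz_represents n v (dual_map (conv_op n G) mu) <->
  ae_eq mu_L setT v (conv_measure G mu).
Proof.
have [f [M Hf]] := regular_kernel rG.
have sGm : sobolev n (conv_measure G mu).
  by move=> k kn; exists (conv_measure (f k) mu); exact: conv_measure_weak_derive Hf _ kn.
have inner u := @sobolev_inner_conv_measure mu f M Hf u.
split=> [[sv Hv]|vG].
(* Both functions represent the same functional; evaluating it at their difference shows that the
   difference has norm 0. *)
- have sw : sobolev n (- 1 *: conv_measure G mu + v) by exact: sobolev_lin.
  have : ae_eq mu_L setT (- 1 *: conv_measure G mu + v) (cst 0).
    apply: (sobolev_inner_definite sw).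
    by rewrite (sobolev_inner_linl (- 1) sGm sv sw) (inner _ sw) (Hv _ sw); lra.
  rewrite /ae_eq => H; apply: (ae_lebesgue_mono H) => x /(_ I) h _.
  have : - 1 * conv_measure G mu x + v x = 0 by exact: h.
  by lra.
- split; first exact: sobolev_ae (ae_eq_sym vG) sGm.
  by move=> u su; rewrite (sobolev_inner_ael _ _ vG) inner.
Qed.

End regular_operator.

Theorem proposition2p2 (R : realType) (n : nat) (G : R -> R)
    (G_even : even_fun G) (G_regular : regular n G) :
  (* the two expressions of T u agree *)
  (forall (u : R -> R) (x : R), sobolev n u ->
     sobolev n (reflect_at G x) /\
     conv_op n G u x = sobolev_inner n (reflect_at G x) u) /\
  (* (1) *)
  ((forall u : R -> R, sobolev n u -> C0 (conv_op n G u)) /\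
   respects_ae n (conv_op n G) /\
   linear_on_sobolev n (conv_op n G)) /\
  (* (2) *)
  (bounded_op n (conv_op n G) /\
   op_norm n (conv_op n G) = (sobolev_norm n G)%:E) /\
  (* (3) *)
  (forall (mu : signed_measure R) (v : R -> R),
     riesz_represents n v (dual_map (conv_op n G) mu) <->
     ae_eq mu_L setT v (conv_measure G mu)).
Proof.
split; first by move=> u x su; split; [exact: sobolev_reflect|exact: conv_op_inner].
split.
  split; first by move=> u; exact: conv_op_C0.
  by split; [exact: conv_op_respects_ae|exact: conv_op_linear].
split; last by move=> mu v; exact: riesz_conv_measure.
split; last exact: op_norm_conv_op.
by exists (sobolev_norm n G) => u; exact: sup_norm_conv_op.
Qed.
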